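(* Let $\mathcal{K}$ be the class of $\mathcal{L}$-structures $(C(X),\tau)$ where $C(X)$ is a finite-dimensional commutative unital C*-algebra (equivalently, $X$ is a finite discrete space) and $\tau$ is an automorphism of $C(X)$. Then $\mathcal{K}$ is a Fra\''iss\'e class, and its Fra\''iss\'e limit is of the form $(C(2^{\mathbb{N}}),\sigma)$, where $\sigma$ is induced by a homeomorphism of the Cantor set $2^{\mathbb{N}}$.
   Context: $\mathcal{L}$ is the language of unital C*-algebras (continuous logic) expanded by a unary function symbol $\sigma$ interpreted as an automorphism; a compact space $X$ with homeomorphism $S$ corresponds to $(C(X),\sigma)$ with $\sigma(f)=f\circ S$. Fra\''iss\'e class and Fra\''iss\'e limit are in the sense of Fra\''iss\'e theory for metric structures / C*-algebras (hereditary property, joint embedding property, amalgamation property, with the limit the unique separable generic structure whose finitely generated substructures are approximately those of the class). *)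

(* Defs.v *)
From HB Require Import structures.
From mathcomp Require Import all_boot all_order all_algebra complex.
From mathcomp Require Import all_classical all_reals all_analysis.
From mathcomp Require Import ring lra.
Import Order.TTheory GRing.Theory Num.Theory numFieldNormedType.Exports.

Set Implicit Arguments.
Unset Strict Implicit.
Unset Printing Implicit Defensive.

Local Open Scope classical_set_scope.
Local Open Scope ring_scope.

Record language := Language {
  symbol : Type;
  arity : symbol -> nat
}.

(* The only predicate symbol is the metric, which is the case of the language
   of C*-algebras (the norm is the distance to the constant 0).  Structures
   need not be bounded and the symbols need only be interpreted by continuous
   functions, as in Ben Yaacov's Fraisse theory of metric structures. *)
Record structure (R : realType) (L : language) := Structure {
  carrier :> metricType R;
  interp : forall s : symbol L, ('I_(arity s) -> carrier) -> carrier;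
  interp_continuous : forall (s : symbol L) (a : 'I_(arity s) -> carrier)
    (e : R), 0 < e -> exists2 d : R, 0 < d &
    forall b : 'I_(arity s) -> carrier,
      (forall i, mdist (a i) (b i) < d) -> mdist (interp a) (interp b) < e;
  carrier_complete : forall u : nat -> carrier,
    cauchy (u @ \oo) -> exists l : carrier, u @ \oo --> l
}.

Section Fraisse.
Variables (R : realType) (L : language).
Implicit Types M N A B C D : structure R L.

Definition embedding M N (phi : M -> N) :=
  (forall x y, mdist (phi x) (phi y) = mdist x y) /\
  (forall (s : symbol L) (a : 'I_(arity s) -> M),
     phi (interp a) = interp (phi \o a)).

Definition isomorphism M N (phi : M -> N) := embedding phi /\ bijective phi.

Definition isomorphic M N := exists phi : M -> N, isomorphism phi.

Definition substructure M (A : set M) :=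
  closed A /\
  (forall (s : symbol L) (a : 'I_(arity s) -> M),
     (forall i, A (a i)) -> A (interp a)).

Definition generates M (I : Type) (a : I -> M) :=
  forall A : set M, substructure A -> (forall i, A (a i)) -> A = setT.

Definition finitely_generated M :=
  exists (n : nat) (a : 'I_n -> M), generates a.

Definition tupled (I : Type) := {M : structure R L & I -> M}.

Definition tupled_of M (I : Type) (a : I -> M) : tupled I := existT _ M a.

Variable K : structure R L -> Prop.

(* The elements of K_I: a member of K with a generating family. *)
Definition generated_member (I : Type) (p : tupled I) :=
  K (projT1 p) /\ generates (projT2 p).

(* For finite I this says that d^K(p, q) < e, where d^K(p, q) is the infimum,
   over all embeddings of the two structures in a common member of K, of the
   maximum of the distances between corresponding images. *)
Definition dK_lt (I : Type) (p q : tupled I) (e : R) :=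
  exists C (phi : projT1 p -> C) (psi : projT1 q -> C),
    [/\ K C, embedding phi, embedding psi &
        forall i, mdist (phi (projT2 p i)) (psi (projT2 q i)) < e].

Definition dK_cauchy (I : Type) (p : nat -> tupled I) :=
  forall e : R, 0 < e ->
    exists N : nat, forall j k, (N <= j)%N -> (N <= k)%N -> dK_lt (p j) (p k) e.

(* The tuple (a_i)_i extended by the value of s at (a_(v 0), a_(v 1), ...). *)
Definition extend (I : Type) (s : symbol L) (v : 'I_(arity s) -> I)
    (p : tupled I) : tupled (option I) :=
  tupled_of (fun o => if o is Some i then projT2 p i
                     else interp (projT2 p \o v)).

Definition hereditary :=
  forall A B (phi : B -> A),
    K A -> embedding phi -> finitely_generated B -> K B.

Definition joint_embedding :=
  forall A B, K A -> K B -> exists C (phi : A -> C) (psi : B -> C),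
    [/\ K C, embedding phi & embedding psi].

(* Exact amalgamation, hence also near amalgamation. *)
Definition amalgamation :=
  forall A B0 B1 (phi0 : A -> B0) (phi1 : A -> B1),
    K A -> K B0 -> K B1 -> embedding phi0 -> embedding phi1 ->
    exists C (psi0 : B0 -> C) (psi1 : B1 -> C),
      [/\ K C, embedding psi0, embedding psi1 &
          psi0 \o phi0 =1 psi1 \o phi1].

(* Each K_n is separable for d^K; no completeness is required, so that classes
   such as that of finite-dimensional algebras are covered. *)
Definition weak_polish :=
  forall n : nat, exists (J : countType) (D : J -> tupled 'I_n),
    (forall j, generated_member (D j)) /\
    (forall p, generated_member p -> forall e : R, 0 < e ->
       exists j, dK_lt p (D j) e).

Definition cauchy_continuity :=
  forall (n : nat) (p : nat -> tupled 'I_n),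
    (forall k, generated_member (p k)) -> dK_cauchy p ->
    forall (s : symbol L) (v : 'I_(arity s) -> 'I_n),
      dK_cauchy (fun k => extend v (p k)).

Record fraisse_class : Prop := FraisseClass {
  fraisse_finitely_generated : forall A, K A -> finitely_generated A;
  fraisse_hereditary : hereditary;
  fraisse_joint_embedding : joint_embedding;
  fraisse_amalgamation : amalgamation;
  fraisse_weak_polish : weak_polish;
  fraisse_cauchy_continuity : cauchy_continuity
}.

Record fraisse_limit (M : structure R L) : Prop := FraisseLimit {
  limit_separable : exists2 D : set M, countable D & dense D;
  limit_approximated : forall (n : nat) (a : 'I_n -> M) (e : R), 0 < e ->
    exists A (phi : A -> M) (b : 'I_n -> A),
      [/\ K A, embedding phi & forall i, mdist (phi (b i)) (a i) < e];
  limit_universal : forall A, K A -> exists phi : A -> M, embedding phi;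
  limit_homogeneous : forall A (phi psi : A -> M),
    K A -> embedding phi -> embedding psi ->
    forall (n : nat) (a : 'I_n -> A) (e : R), 0 < e ->
      exists2 alpha : M -> M, isomorphism alpha &
        forall i, mdist (alpha (phi (a i))) (psi (a i)) < e
}.

End Fraisse.

(* Nonempty, so that 1 <> 0 in C(X). *)
Record compactum := Compactum {
  point_space :> topologicalType;
  compactum_compact : compact [set: point_space];
  compactum_hausdorff : hausdorff_space point_space;
  compactum_inhabited : inhabited point_space
}.

Record homeo (X : topologicalType) := Homeo {
  homeo_fun :> X -> X;
  homeo_inv : X -> X;
  homeo_continuous : continuous homeo_fun;
  homeo_inv_continuous : continuous homeo_inv;
  homeo_funK : cancel homeo_fun homeo_inv;
  homeo_invK : cancel homeo_inv homeo_fun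
}.

Definition cantor_compactum : compactum :=
  Compactum cantor_space_compact cantor_space_hausdorff
            (inhabits (point : cantor_space)).

(* The R-valued modulus of a complex number. *)
Notation normc := ComplexField.Normc.normc.

Section Modulus.
Variable R : realType.
Implicit Types z w : R[i].

Lemma normC_normc z : `|z| = (normc z)%:C%C.
Proof. by []. Qed.

Lemma normc_ge0 z : 0 <= normc z.
Proof. by case: z => a b; exact: sqrtr_ge0. Qed.

Lemma normcD z w : normc (z + w) <= normc z + normc w.
Proof. exact: le_normcD. Qed.

Lemma normcBC z w : normc (z - w) = normc (w - z).
Proof. by rewrite -opprB; exact: normcN. Qed.

Lemma normc_dist z w t : normc (z - t) <= normc (z - w) + normc (w - t).
Proof.
have -> : z - t = (z - w) + (w - t) by rewrite addrA subrK.
exact: normcD.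
Qed.

Lemma continuousCP (X : topologicalType) (f : X -> R[i]) :
  continuous (f : X -> R[i]^o) <->
  (forall x (e : R), 0 < e -> \forall y \near x, normc (f x - f y) < e).
Proof.
split=> fc x.
- move=> e e0; have /cvgrPdist_lt/(_ e%:C%C) := fc x.
  rewrite ltcR => /(_ e0); apply: filterS => y.
  by rewrite (normC_normc (f x - f y)) ltcR.
- apply/cvgrPdist_lt => e e0.
  have ee : e = (complex.Re e)%:C%C.
    by move: e0; rewrite ltcE /= => /andP[/eqP]; case: e => a b /= ->.
  move: e0; rewrite ee ltcR => e0.
  apply: filterS (fc x _ e0) => y.
  by rewrite (normC_normc (f x - f y)) ltcR.
Qed.

Lemma normc_conj z : normc z^*%C = normc z.
Proof. by case: z => a b /=; rewrite sqrrN. Qed.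

Lemma normc_Re z : `|complex.Re z| <= normc z.
Proof. by case: z => a b /=; rewrite -sqrtr_sqr ler_wsqrtr// lerDl sqr_ge0. Qed.

Lemma normc_Im z : `|complex.Im z| <= normc z.
Proof. by case: z => a b /=; rewrite -sqrtr_sqr ler_wsqrtr// lerDr sqr_ge0. Qed.

Lemma normc_ReIm z : normc z <= `|complex.Re z| + `|complex.Im z|.
Proof.
case: z => a b /=; rewrite -[leRHS]ger0_norm ?addr_ge0// -sqrtr_sqr.
rewrite ler_wsqrtr// sqrrD !real_normK ?num_real// lerD2r lerDl.
by rewrite mulrn_wge0// mulr_ge0.
Qed.

Lemma real_cauchy_limit (a : nat -> R) :
  (forall e : R, 0 < e -> exists N, forall j k, (N <= j)%N -> (N <= k)%N ->
     `|a j - a k| < e) ->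
  exists l, forall e : R, 0 < e -> exists N, forall k, (N <= k)%N ->
    `|a k - l| < e.
Proof.
move=> ac.
have /cauchy_cvgP al : cauchy (a @ \oo).
  apply/cauchy_ballP => e e0; have [N aN] := ac _ e0.
  rewrite near_map2 /=.
  exists ([set k | (N <= k)%N], [set k | (N <= k)%N]); last first.
    by move=> [j k] /= [Nj Nk]; exact: aN.
  by split; exists N.
exists (lim (a @ \oo)) => e e0.
have /cvgrPdist_lt/(_ e e0)[N _ aN] := al.
by exists N => k Nk; rewrite distrC; exact: aN.
Qed.

Lemma normc_cauchy_limit (z : nat -> R[i]) :
  (forall e : R, 0 < e -> exists N, forall j k, (N <= j)%N -> (N <= k)%N ->
     normc (z j - z k) < e) ->
  exists l, forall e : R, 0 < e -> exists N, forall k, (N <= k)%N ->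
    normc (z k - l) < e.
Proof.
move=> zc.
have [|a za] := @real_cauchy_limit (fun k => complex.Re (z k)).
  move=> e /zc[N zN]; exists N => j k Nj Nk.
  by apply: le_lt_trans (zN j k Nj Nk); rewrite -raddfB normc_Re.
have [|b zb] := @real_cauchy_limit (fun k => complex.Im (z k)).
  move=> e /zc[N zN]; exists N => j k Nj Nk.
  by apply: le_lt_trans (zN j k Nj Nk); rewrite -raddfB normc_Im.
exists (a +i* b)%C => e e0; have e20 : 0 < e / 2 by rewrite divr_gt0.
have [N1 zN1] := za _ e20; have [N2 zN2] := zb _ e20.
exists (maxn N1 N2) => k; rewrite geq_max => /andP[k1 k2].
apply: le_lt_trans (normc_ReIm _) _; rewrite (splitr e) !raddfB /=.
by rewrite ltrD// ?zN1// zN2.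
Qed.

End Modulus.

Section ContinuousFunctions.
Variables (R : realType) (X : compactum).

Definition Cfun : Type := continuousType X (R[i])^o.

HB.instance Definition _ := Choice.on Cfun.

Implicit Types f g h : Cfun.

Lemma Cfun_near f x (e : R) :
  0 < e -> \forall y \near x, normc (f x - f y : R[i]) < e.
Proof. exact: (continuousCP (f : X -> R[i])).1 (cts_fun (s := f)) x e. Qed.

(* The supremum norm of f - g; the supremum is attained since X is compact. *)
Definition Cdist f g : R := sup (range (fun x => normc (f x - g x : R[i]))).

Lemma Cdist_has_sup f g : has_sup (range (fun x => normc (f x - g x : R[i]))).
Proof.
have [x0] := compactum_inhabited X.
apply: compact_has_sup; first by exists (normc (f x0 - g x0 : R[i])); exists x0.
apply: continuous_compact; last exact: compactum_compact.
apply: continuous_subspaceT => x.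
apply/cvgrPdist_lt => e e0.
have e20 : 0 < e / 2 by rewrite divr_gt0.
near=> y.
have fxy : normc (f x - f y : R[i]) < e / 2.
  by near: y; exact: Cfun_near.
have gxy : normc (g x - g y : R[i]) < e / 2.
  by near: y; exact: Cfun_near.
set u := (f x - g x : R[i]); set v := (f y - g y : R[i]).
have uv : normc (u - v) < e.
  have -> : u - v = (f x - f y : R[i]) + (g y - g x : R[i]).
    by rewrite /u /v opprB addrACA [in RHS]addrACA; congr (_ + _); rewrite addrC.
  rewrite (le_lt_trans (normcD _ _))// (splitr e) ltrD//.
  by rewrite normcBC.
have uv1 : normc u <= normc (u - v) + normc v.
  by rewrite -{1}(subrK v u) normcD.
have uv2 : normc v <= normc (u - v) + normc u.
  by rewrite normcBC -{1}(subrK u v) normcD.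
rewrite ltr_distl; apply/andP; split.
  by rewrite ltrBlDr (le_lt_trans uv2)// addrC ltrD2l.
by rewrite (le_lt_trans uv1)// addrC ltrD2l.
Unshelve. all: by end_near. Qed.

Lemma Cdist_ub f g x : normc (f x - g x : R[i]) <= Cdist f g.
Proof. by have [_ ub] := Cdist_has_sup f g; apply: (ub_le_sup ub); exists x. Qed.

Lemma Cdist_le f g (e : R) :
  (forall x, normc (f x - g x : R[i]) <= e) -> Cdist f g <= e.
Proof.
move=> fge; apply: ge_sup; first by case: (Cdist_has_sup f g).
by move=> _ [x _ <-].
Qed.

Lemma Cdistxx f : Cdist f f = 0.
Proof.
have [x0] := compactum_inhabited X.
apply/eqP; rewrite eq_le; apply/andP; split.
  by apply: Cdist_le => x; rewrite subrr ComplexField.Normc.normc0.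
by rewrite (le_trans (normc_ge0 (f x0 - f x0)))// Cdist_ub.
Qed.

Lemma Cdist_positivity f g : Cdist f g = 0 -> f = g.
Proof.
move=> fg0; apply/continuousEP => x.
apply/eqP; rewrite -subr_eq0; apply/eqP.
apply: ComplexField.Normc.eq0_normc; apply/eqP.
by rewrite eq_le normc_ge0 andbT -fg0 Cdist_ub.
Qed.

Lemma Cdist_sym f g : Cdist f g = Cdist g f.
Proof.
rewrite /Cdist; congr sup; congr (image _ _).
by apply/funext => x; rewrite normcBC.
Qed.

Lemma Cdist_triangle g f h : Cdist f h <= Cdist f g + Cdist g h.
Proof.
apply: Cdist_le => x; rewrite (le_trans (normc_dist _ (g x) _))//.
by apply: lerD; exact: Cdist_ub.
Qed.

HB.instance Definition _ := @isMetric.Build R Cfun Cdist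
  Cdistxx Cdist_positivity Cdist_sym Cdist_triangle.

Lemma Cfun_mdistE f g : mdist f g = Cdist f g.
Proof. by []. Qed.

Lemma Cfun_complete (u : nat -> Cfun) :
  cauchy (u @ \oo) -> exists l : Cfun, u @ \oo --> l.
Proof.
move=> /cauchy_ballP uc.
have uC (e : R) : 0 < e -> exists N, forall j k, (N <= j)%N -> (N <= k)%N ->
    forall x, normc (u j x - u k x : R[i]) < e.
  move=> e0.
  have [[A B] /= [[N1 _ N1A] [N2 _ N2B]] AB] := uc e e0.
  exists (maxn N1 N2) => j k; rewrite !geq_max => /andP[j1 _] /andP[_ k2] x.
  apply: le_lt_trans (Cdist_ub _ _ _) _.
  have := AB (u j, u k) (conj (N1A _ j1) (N2B _ k2)).
  by rewrite /= ballEmdist.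
have [l ul] : exists l : X -> R[i], forall x (e : R), 0 < e ->
    exists N, forall k, (N <= k)%N -> normc (u k x - l x : R[i]) < e.
  suff /choice[l ul] : forall x, exists l : R[i], forall e : R, 0 < e ->
      exists N, forall k, (N <= k)%N -> normc (u k x - l : R[i]) < e.
    by exists l.
  move=> x.
  apply: normc_cauchy_limit => e /uC[N uN].
  by exists N => j k Nj Nk; exact: uN.
have ulC (e : R) : 0 < e -> exists N, forall j, (N <= j)%N ->
    forall x, normc (u j x - l x : R[i]) < e.
  move=> e0; have e20 : 0 < e / 2 by rewrite divr_gt0.
  have [N uN] := uC _ e20; exists N => j Nj x.
  have [N' uN'] := ul x _ e20.
  apply: le_lt_trans (normc_dist _ (u (maxn N N') x) _) _.
  rewrite (splitr e) ltrD// ?uN'// ?leq_maxr//.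
  by apply: uN => //; exact: leq_maxl.
have lc : continuous (l : X -> R[i]^o).
  apply/continuousCP => x e e0; have e30 : 0 < e / 3 by rewrite divr_gt0.
  have [N uN] := ulC _ e30; near=> y.
  have fxy : normc (u N x - u N y : R[i]) < e / 3.
    by near: y; exact: Cfun_near.
  have e3 : e = e / 3 + (e / 3 + e / 3) by field.
  rewrite e3; apply: le_lt_trans (normc_dist _ (u N x) _) _.
  rewrite ltrD//; first by rewrite normcBC uN.
  apply: le_lt_trans (normc_dist _ (u N y) _) _.
  by rewrite ltrD// uN.
exists (mkcts lc : Cfun); apply/cvg_ballP => e e0.
have e20 : 0 < e / 2 by rewrite divr_gt0.
have [N uN] := ulC _ e20; exists N => // k Nk /=; rewrite ballEmdist /=.
rewrite metric_sym Cfun_mdistE; apply: (@le_lt_trans _ _ (e / 2)).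
  by apply: Cdist_le => x; exact: ltW (uN _ Nk x).
by rewrite ltr_pdivrMr// ltr_pMr// ltr1n.
Unshelve. all: by end_near. Qed.

Lemma Cst_continuous (c : R[i]) : continuous (cst c : X -> R[i]^o).
Proof. by move=> x; exact: cvg_cst. Qed.

Lemma Cadd_continuous f g : continuous (fun x => f x + g x).
Proof. by move=> x; apply: cvgD; exact: (cts_fun (s := _)). Qed.

Lemma Cmul_continuous f g :
  continuous ((fun x => (f x : R[i]) * (g x : R[i])) : X -> R[i]^o).
Proof. by move=> x; apply: cvgM; exact: (cts_fun (s := _)). Qed.

Lemma Cstar_continuous f :
  continuous ((fun x => (f x : R[i])^*%C) : X -> R[i]^o).
Proof.
apply/continuousCP => x e e0; apply: filterS (Cfun_near f x e0) => y.
by rewrite -[in X in _ -> X]raddfB normc_conj.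
Qed.

Definition Cconst (c : R[i]) : Cfun := mkcts (@Cst_continuous c).
Definition Cadd f g : Cfun := mkcts (@Cadd_continuous f g).
Definition Cmul f g : Cfun := mkcts (@Cmul_continuous f g).
Definition Cscale (c : R[i]) f : Cfun := Cmul (Cconst c) f.
Definition Cstar f : Cfun := mkcts (@Cstar_continuous f).

Lemma Cadd_dist f f' g g' :
  Cdist (Cadd f g) (Cadd f' g') <= Cdist f f' + Cdist g g'.
Proof.
apply: Cdist_le => x /=.
have -> : f x + g x - (f' x + g' x) = (f x - f' x : R[i]) + (g x - g' x : R[i]).
  by rewrite opprD addrACA.
by apply: le_trans (normcD _ _) _; apply: lerD; exact: Cdist_ub.
Qed.

Lemma Cnorm_ub f x : normc (f x : R[i]) <= Cdist f (Cconst 0).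
Proof. by have := Cdist_ub f (Cconst 0) x; rewrite /= subr0. Qed.

Lemma Cmul_dist f f' g g' :
  Cdist (Cmul f g) (Cmul f' g') <=
  Cdist f f' * Cdist g (Cconst 0) + Cdist f' (Cconst 0) * Cdist g g'.
Proof.
apply: Cdist_le => x /=.
have -> : (f x : R[i]) * g x - (f' x : R[i]) * g' x =
    (f x - f' x : R[i]) * g x + (f' x : R[i]) * (g x - g' x : R[i]).
  by rewrite mulrBl mulrBr subrKA.
apply: le_trans (normcD _ _) _; rewrite !ComplexField.Normc.normcM.
apply: lerD; apply: ler_pM; rewrite ?normc_ge0//;
  by [exact: Cdist_ub | exact: Cnorm_ub].
Qed.

Lemma Cstar_dist f g : Cdist (Cstar f) (Cstar g) <= Cdist f g.
Proof.
apply: Cdist_le => x; rewrite -[X in normc X](raddfB conjc (f x) (g x)).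
by rewrite normc_conj; exact: Cdist_ub.
Qed.

Lemma Cdist_ge0 f g : 0 <= Cdist f g.
Proof. exact: (mdist_ge0 (f : Cfun) g). Qed.

End ContinuousFunctions.

(* Isometry is automatic, see aut_contraction. *)
Record automorphism (R : realType) (X : compactum) := Automorphism {
  aut_fun :> Cfun R X -> Cfun R X;
  aut_bijective : bijective aut_fun;
  aut_add : forall f g, aut_fun (Cadd f g) = Cadd (aut_fun f) (aut_fun g);
  aut_mul : forall f g, aut_fun (Cmul f g) = Cmul (aut_fun f) (aut_fun g);
  aut_scale : forall c f, aut_fun (Cscale c f) = Cscale c (aut_fun f);
  aut_star : forall f, aut_fun (Cstar f) = Cstar (aut_fun f);
  aut_one : aut_fun (Cconst X 1) = Cconst X 1
}.

Lemma aut_contraction (R : realType) (X : compactum) (tau : automorphism R X)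
  (f g : Cfun R X) : Cdist (tau f) (tau g) <= Cdist f g.
Proof.
apply: Cdist_le => x; rewrite leNgt; apply/negP => fgx.
set c : R[i] := (tau f x - tau g x : R[i]) in fgx.
pose h := Cadd (Cadd f (Cscale (-1) g)) (Cscale (- c) (Cconst X 1)).
have hE y : h y = (f y - g y : R[i]) - c.
  transitivity ((f y : R[i]) + -1 * (g y : R[i]) + - c * 1); first by [].
  by rewrite mulN1r mulr1.
have h0 y : (h y : R[i]) != 0.
  rewrite hE subr_eq0; apply/eqP => fgc.
  by have := Cdist_ub f g y; rewrite fgc leNgt fgx.
have hc : continuous ((fun y => (h y : R[i])^-1) : X -> R[i]^o).
  by move=> y; apply: cvgV; [exact: h0 | exact: (cts_fun (s := _))].
have hV : Cmul h (mkcts hc) = Cconst X 1.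
  by apply/continuousEP => y; exact: divff (h0 y).
have := congr1 tau hV; rewrite aut_mul aut_one /h !aut_add !aut_scale aut_one.
move=> /(congr1 (fun k : Cfun R X => k x : R[i])) tau_hV.
have : ((tau f x : R[i]) + -1 * (tau g x : R[i]) + - c * 1) *
  (tau (mkcts hc) x : R[i]) = 1 := tau_hV.
by rewrite mulN1r mulr1 subrr mul0r => /esym/eqP; apply/negP; exact: oner_neq0.
Qed.

Section InducedAutomorphism.
Variables (R : realType) (X : compactum) (S : homeo X).

Lemma comp_homeo_continuous (f : Cfun R X) : continuous (f \o S).
Proof.
move=> x; apply: continuous_comp; first exact: homeo_continuous.
exact: (cts_fun (s := _)).
Qed.

Definition comp_homeo (f : Cfun R X) : Cfun R X :=
  mkcts (@comp_homeo_continuous f).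

End InducedAutomorphism.

Lemma comp_homeo_bijective (R : realType) (X : compactum) (S : homeo X) :
  bijective (@comp_homeo R X S).
Proof.
pose S' := Homeo (homeo_inv_continuous (h := S)) (homeo_continuous (h := S))
  (homeo_invK S) (homeo_funK S).
exists (comp_homeo S') => f; apply/continuousEP => x.
  exact (congr1 (fun y => f y) (homeo_invK S x)).
exact (congr1 (fun y => f y) (homeo_funK S x)).
Qed.

Definition induced_automorphism (R : realType) (X : compactum) (S : homeo X) :
  automorphism R X.
Proof.
refine (@Automorphism R X (@comp_homeo R X S) (comp_homeo_bijective R S)
  _ _ _ _ _).
all: by move=> *; apply/continuousEP.
Defined.

Inductive cstar_symbol (R : realType) :=
  | Zero | One | Add | Mul | Star | Scale of R[i] | Sigma.

Definition cstar_arity (R : realType) (s : cstar_symbol R) : nat :=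
  match s with
  | Zero | One => 0
  | Add | Mul => 2
  | Star | Scale _ | Sigma => 1
  end.

Definition cstar_language (R : realType) : language :=
  Language (@cstar_arity R).

Section Dynamics.
Variables (R : realType) (X : compactum) (tau : automorphism R X).

Definition dynamics_interp (s : cstar_symbol R) :
    ('I_(cstar_arity s) -> Cfun R X) -> Cfun R X :=
  match s with
  | Zero => fun=> Cconst X 0
  | One => fun=> Cconst X 1
  | Add => fun a => Cadd (a ord0) (a ord_max)
  | Mul => fun a => Cmul (a ord0) (a ord_max)
  | Star => fun a => Cstar (a ord0)
  | Scale c => fun a => Cscale c (a ord0)
  | Sigma => fun a => tau (a ord0)
  end.

Lemma dynamics_interp_continuous (s : cstar_symbol R)
  (a : 'I_(cstar_arity s) -> Cfun R X) (e : R) : 0 < e ->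
  exists2 d : R, 0 < d & forall b : 'I_(cstar_arity s) -> Cfun R X,
    (forall i, mdist (a i) (b i) < d) ->
    mdist (dynamics_interp a) (dynamics_interp b) < e.
Proof.
have mulc f g (e' : R) : 0 < e' -> exists2 d : R, 0 < d &
    forall f' g' : Cfun R X, mdist f f' < d -> mdist g g' < d ->
      mdist (Cmul f g) (Cmul f' g') < e'.
  move=> e'0; set F := Cdist f (Cconst X 0); set G := Cdist g (Cconst X 0).
  have F0 : 0 <= F := Cdist_ge0 _ _; have G0 : 0 <= G := Cdist_ge0 _ _.
  have FG : 0 < F + G + 2 by rewrite ltr_wpDl ?addr_ge0.
  exists (Num.min 1 (e' / (F + G + 2))).
    by rewrite lt_min ltr01 divr_gt0.
  move=> f' g'; rewrite !lt_min !Cfun_mdistE => /andP[f1 fe] /andP[_ ge].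
  have F'F : Cdist f' (Cconst X 0) <= F + 1.
    apply: le_trans (Cdist_triangle f _ _) _.
    by rewrite addrC lerD2l Cdist_sym ltW.
  apply: le_lt_trans (Cmul_dist _ _ _ _) _.
  apply: (@le_lt_trans _ _
    (e' / (F + G + 2) * G + (F + 1) * (e' / (F + G + 2)))).
    by rewrite lerD// ler_pM ?Cdist_ge0// ltW.
  rewrite [X in X + _]mulrC -mulrDl mulrA ltr_pdivrMr// mulrC ltr_pM2l//.
  by lra.
case: s a => [||||| c|] a e0 /=.
- by exists 1 => // b _; rewrite mdistxx.
- by exists 1 => // b _; rewrite mdistxx.
- exists (e / 2); first by rewrite divr_gt0.
  move=> b ab; rewrite Cfun_mdistE.
  by apply: le_lt_trans (Cadd_dist _ _ _ _) _; rewrite (splitr e) ltrD// ab.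
- have [d d0 dP] := mulc (a ord0) (a ord_max) e e0.
  by exists d => // b ab; exact: dP.
- by exists e => // b ab; exact: le_lt_trans (Cstar_dist _ _) (ab _).
- have [d d0 dP] := mulc (Cconst X c) (a ord0) e e0; exists d => // b ab.
  by apply: dP => //; rewrite mdistxx.
- by exists e => // b ab; exact: le_lt_trans (aut_contraction _ _ _) (ab _).
Qed.

Definition dynamics : structure R (cstar_language R) :=
  @Structure R (cstar_language R) (Cfun R X) dynamics_interp
    dynamics_interp_continuous (@Cfun_complete R X).

End Dynamics.

Definition finite_dimensional (R : realType) (X : compactum) :=
  exists (n : nat) (b : 'I_n -> Cfun R X), forall f : Cfun R X,
    exists c : 'I_n -> R[i], forall x, f x = \sum_(i < n) c i * b i x.

Definition finite_dimensional_dynamics (R : realType)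
    (M : structure R (cstar_language R)) : Prop :=
  exists (X : compactum) (tau : automorphism R X),
    finite_dimensional R X /\ isomorphic M (dynamics tau).

(* Main.v *)
(** By Gelfand duality an object of the class is a permutation of a finite
    nonempty set, and an embedding of such an object into (C(X), tau) is
    composition with an equivariant continuous surjection of X onto the set.
    Amalgams are therefore fiber products and substructures are quotients.

    In a Fraisse limit M two idempotents at distance < 1/2 are equal, because
    near-idempotents of a finite-dimensional algebra can be rounded to
    {0,1}-valued functions.  Hence the approximate homogeneity and
    approximation properties of M become exact on finite-dimensional
    subalgebras, and an exact back-and-forth argument gives both uniqueness
    and homogeneity.

    For existence, the shift is z |-> z + 1 on the first factor of each
    coordinate of the product over k of Z/(k+2)! x {0, ..., k+1}, a space
    homeomorphic to the Cantor set.  An equivariant map pi of this space onto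
    a finite T depends on finitely many coordinates and so lifts through any
    equivariant surjection g : U -> T: a further coordinate (z, t) supplies
    both a section of the orbits and an independent invariant t ranging over
    the fibers of g. *)
Require Import Defs.
From HB Require Import structures.
From mathcomp Require Import all_boot all_order all_algebra all_fingroup complex.
From mathcomp Require Import all_classical all_reals all_analysis.
From mathcomp Require Import ring lra.
Import Order.TTheory GRing.Theory Num.Theory numFieldNormedType.Exports.

Set Implicit Arguments.
Unset Strict Implicit.
Unset Printing Implicit Defensive.

Local Open Scope classical_set_scope.
Local Open Scope ring_scope.

(** * Embeddings of metric structures *)

Section Embeddings.
Variables (R : realType) (L : language).
Implicit Types M N A B C : structure R L.

Lemma embedding_id M : embedding (id : M -> M).
Proof. by split. Qed.

Lemma embedding_comp A B C (f : B -> C) (g : A -> B) :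
  embedding f -> embedding g -> embedding (f \o g).
Proof.
move=> [fd fi] [gd gi]; split=> [x y|s a] /=; first by rewrite fd gd.
by rewrite gi fi.
Qed.

Lemma embedding_inj A B (f : A -> B) : embedding f -> injective f.
Proof.
move=> [fd _] x y fxy; apply: mdist_positivity.
by rewrite -fd fxy mdistxx.
Qed.

(** Turns an inclusion of images into an embedding: since [g] is isometric and injective, the chosen
    preimages inherit distances and commute with every symbol. *)
Lemma factor_embedding A B C (f : A -> C) (g : B -> C) :
  embedding f -> embedding g -> (forall x, exists y, g y = f x) ->
  exists2 h : A -> B, embedding h & forall x, g (h x) = f x.
Proof.
move=> ef eg /choice[h hE]; exists h => //.
have [fd fi] := ef; have [gd gi] := eg.
split=> [x y|s a]; first by rewrite -gd !hE fd.
apply: (embedding_inj eg); rewrite gi hE fi; congr interp.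
by apply/funext => i /=; rewrite hE.
Qed.

Lemma embedding_isomorphism A B (f : A -> B) :
  embedding f -> (forall y, exists x, f x = y) -> isomorphism f.
Proof.
move=> ef /choice[g gE]; split => //; exists g => [x|//].
by apply: (embedding_inj ef); rewrite gE.
Qed.

Lemma isomorphic_sym M N : isomorphic M N -> isomorphic N M.
Proof.
move=> [f [ef [g fK gK]]].
have [h eh hE] : exists2 h : N -> M, embedding h & forall x, f (h x) = x.
  by apply: (factor_embedding (embedding_id N) ef) => y; exists (g y).
exists h; apply: embedding_isomorphism => // x; exists (f x).
by apply: (can_inj fK); rewrite hE.
Qed.

Lemma isomorphic_trans M N A :
  isomorphic M N -> isomorphic N A -> isomorphic M A.
Proof.
move=> [f [ef bf]] [g [eg bg]]; exists (g \o f); split.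
  exact: embedding_comp.
exact: bij_comp.
Qed.

End Embeddings.

(** * Algebra operations and their preservation by embeddings *)

Section Operations.
Variable R : realType.
Implicit Types M N : structure R (cstar_language R).

Definition pair2 (A : Type) (x y : A) : 'I_2 -> A :=
  fun i => if i == ord0 then x else y.

Definition no_args (A : Type) : 'I_0 -> A.
Proof. by case. Defined.

Definition op_zero M : M :=
  @interp R (cstar_language R) M (Zero R) (@no_args M).
Definition op_one M : M :=
  @interp R (cstar_language R) M (One R) (@no_args M).
Definition op_add M (x y : M) : M :=
  @interp R (cstar_language R) M (Add R) (pair2 x y).
Definition op_mul M (x y : M) : M :=
  @interp R (cstar_language R) M (Mul R) (pair2 x y).
Definition op_scale M (c : R[i]) (x : M) : M :=
  @interp R (cstar_language R) M (Scale c) (fun=> x).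
Definition op_sigma M (x : M) : M :=
  @interp R (cstar_language R) M (Sigma R) (fun=> x).

Section Morphism.
Variables (M N : structure R (cstar_language R)) (f : M -> N).
Hypothesis ef : embedding f.

Lemma embedding_zero : f (op_zero M) = op_zero N.
Proof. by rewrite (ef.2 (Zero R)); congr interp; apply/funext; case. Qed.

Lemma embedding_one : f (op_one M) = op_one N.
Proof. by rewrite (ef.2 (One R)); congr interp; apply/funext; case. Qed.

Lemma embedding_add x y : f (op_add x y) = op_add (f x) (f y).
Proof.
rewrite (ef.2 (Add R)); congr interp; apply/funext => i /=.
by rewrite /pair2; case: ifP.
Qed.

Lemma embedding_mul x y : f (op_mul x y) = op_mul (f x) (f y).
Proof.
rewrite (ef.2 (Mul R)); congr interp; apply/funext => i /=.
by rewrite /pair2; case: ifP.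
Qed.

Lemma embedding_scale c x : f (op_scale c x) = op_scale c (f x).
Proof. exact: (ef.2 (Scale c) (fun=> x)). Qed.

Lemma embedding_sigma x : f (op_sigma x) = op_sigma (f x).
Proof. exact: (ef.2 (Sigma R) (fun=> x)). Qed.

End Morphism.
End Operations.

(** * Pointwise evaluation and composition with surjections *)

Section Evaluation.
Variables (R : realType) (X : compactum).
Implicit Types f g : Cfun R X.

Lemma eval_const c x : Cconst X c x = c :> R[i]. Proof. by []. Qed.
Lemma eval_add f g x : Cadd f g x = (f x : R[i]) + g x. Proof. by []. Qed.
Lemma eval_mul f g x : Cmul f g x = (f x : R[i]) * g x. Proof. by []. Qed.
Lemma eval_scale c f x : Cscale c f x = c * (f x : R[i]). Proof. by []. Qed.
Lemma eval_star f x : Cstar f x = (f x : R[i])^*%C. Proof. by []. Qed.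

End Evaluation.

Definition evalE :=
  (eval_const, eval_add, eval_scale, eval_mul, eval_star).

Section Pullback.
Variables (R : realType) (X Y : compactum).

Lemma CfunP (f g : Cfun R X) : (forall x, f x = g x :> R[i]) -> f = g.
Proof. by move=> fg; apply/continuousEP => x; exact: fg. Qed.

(* Surjectivity of [pi] makes composition with it isometric. *)
Lemma pullback_embedding (tauX : automorphism R X) (tauY : automorphism R Y)
    (Phi : dynamics tauY -> dynamics tauX) (pi : X -> Y) :
  (forall (f : Cfun R Y) x, (Phi f : Cfun R X) x = f (pi x) :> R[i]) ->
  (forall y, exists x, pi x = y) ->
  (forall f : Cfun R Y, Phi (tauY f) = tauX (Phi f)) ->
  embedding Phi.
Proof.
move=> PhiE pisurj Phitau; split.
  move=> f g; rewrite !Cfun_mdistE; apply/eqP; rewrite eq_le.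
  apply/andP; split; apply: Cdist_le.
    by move=> x; rewrite !PhiE; exact: Cdist_ub.
  move=> y; have [x <-] := pisurj y; rewrite -!PhiE; exact: Cdist_ub.
case=> [||||| c|] a; rewrite [interp]/= ?Phitau//.
all: by apply: CfunP => x; rewrite PhiE ?evalE ?PhiE.
Qed.

End Pullback.

(** * Permutations of finite sets and their function algebras *)

Section FiniteDynamics.
Variable R : realType.

Section Space.
Variables (T : finType) (t0 : T).

Lemma finite_space_compact : compact [set: discrete_topology T].
Proof. by apply: finite_compact; exact: (@finite_finset T). Qed.

Definition finite_compactum : compactum :=
  @Compactum (discrete_topology T) finite_space_compact
    (@discrete_hausdorff (discrete_topology T)) (inhabits t0).

Lemma finite_compactum_continuous (Y : topologicalType)
  (f : finite_compactum -> Y) : continuous f.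
Proof.
move=> x A fA; rewrite /= nbhs_principalE.
by apply/principal_filterP; exact: nbhs_singleton fA.
Qed.

Definition finite_fun (f : T -> R[i]) : Cfun R finite_compactum :=
  mkcts (@finite_compactum_continuous _ (f : _ -> R[i]^o)).

Lemma finite_funE f t : finite_fun f t = f t. Proof. by []. Qed.

Definition delta (t : T) : Cfun R finite_compactum :=
  finite_fun (fun u => (u == t)%:R).

Lemma deltaE t u : delta t u = (u == t)%:R :> R[i]. Proof. by []. Qed.

(** The delta functions span the algebra of a finite space, so a property stable under linear
    combinations need only be checked on them. *)
Lemma finite_fun_ind (P : Cfun R finite_compactum -> Prop) :
  P (Cconst _ 0) -> (forall f g, P f -> P g -> P (Cadd f g)) ->
  (forall c f, P f -> P (Cscale c f)) -> (forall t, P (delta t)) ->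
  forall f, P f.
Proof.
move=> P0 PD PZ Pdelta f.
(* [fs s] is [f] cut off outside [s]; each new point adds one multiple of a delta function. *)
pose fs (s : seq T) := finite_fun (fun t => if t \in s then f t else 0).
have -> : f = fs (enum T).
  by apply: CfunP => t; rewrite finite_funE mem_enum.
elim: (enum T) => [|a s IHs].
  by have -> : fs [::] = Cconst _ 0 by exact: CfunP.
have [sa|sa] := boolP (a \in s).
  suff -> : fs (a :: s) = fs s by [].
  apply: CfunP => t; rewrite !finite_funE inE.
  by case: eqP => // ->; rewrite sa.
have -> : fs (a :: s) = Cadd (Cscale (f a) (delta a)) (fs s); last first.
  by apply: PD => //; apply: PZ.
apply: CfunP => t.
transitivity ((f a : R[i]) * (t == a)%:R + (if t \in s then f t else 0)).
  rewrite !finite_funE inE; case: eqP => [->|_] /=.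
    by rewrite (negPf sa) mulr1 addr0.
  by rewrite mulr0 add0r.
by [].
Qed.

Definition perm_homeo (p : {perm T}) : homeo finite_compactum.
Proof.
refine (@Homeo finite_compactum (p : T -> T) (p^-1%g : T -> T) _ _ _ _).
- exact: finite_compactum_continuous.
- exact: finite_compactum_continuous.
- exact: permK.
- exact: permKV.
Defined.

Definition finite_dynamics (p : {perm T}) : structure R (cstar_language R) :=
  dynamics (induced_automorphism R (perm_homeo p)).

(* A character of C(T) does not vanish on some delta function, and
   [delta t * f = f t * delta t] then identifies it with evaluation at t. *)
Lemma finite_character (chi : Cfun R finite_compactum -> R[i]) :
  (forall f g, chi (Cadd f g) = chi f + chi g) ->
  (forall f g, chi (Cmul f g) = chi f * chi g) ->
  (forall c f, chi (Cscale c f) = c * chi f) ->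
  (exists f, chi f != 0) -> exists t, forall f, chi f = f t.
Proof.
move=> chiD chiM chiZ [g g0].
have [[t tP]|/forallNP H] := pselect (exists t, chi (delta t) != 0).
  exists t => f; apply: (mulfI tP); rewrite -chiM mulrC -chiZ.
  congr chi; apply: CfunP => u.
  transitivity ((u == t)%:R * f u : R[i]); first by [].
  transitivity (f t * (u == t)%:R : R[i]); last by [].
  by case: eqP => [->|_]; rewrite ?mulr1 ?mul1r// mulr0 mul0r.
case/eqP: g0; elim/finite_fun_ind: g => [|f h f0 h0|c f f0|t].
- have -> : Cconst finite_compactum 0 = Cscale 0 (Cconst _ 0) :> Cfun R _.
    by apply: CfunP => t; rewrite !evalE mul0r.
  by rewrite chiZ mul0r.
- by rewrite chiD f0 h0 addr0.
- by rewrite chiZ f0 mulr0.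
- by have /negP/negPn/eqP := H t.
Qed.

(** Gelfand duality for a finite source: following [Phi] by evaluation at [x] gives a character,
    hence evaluation at some point, taken as [pi x]. *)
Lemma finite_hom_pullback (X : compactum)
    (Phi : Cfun R finite_compactum -> Cfun R X) :
  (forall f g, Phi (Cadd f g) = Cadd (Phi f) (Phi g)) ->
  (forall f g, Phi (Cmul f g) = Cmul (Phi f) (Phi g)) ->
  (forall c f, Phi (Cscale c f) = Cscale c (Phi f)) ->
  Phi (Cconst _ 1) = Cconst _ 1 ->
  exists pi : X -> T, forall f x, Phi f x = f (pi x) :> R[i].
Proof.
move=> PhiD PhiM PhiZ Phi1.
suff /choice[pi piE] : forall x, exists t, forall f, Phi f x = f t :> R[i].
  by exists pi => f x; exact: piE.
move=> x; apply: (@finite_character (fun f => Phi f x : R[i])) => [f g|f g|c f|].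
- by rewrite PhiD.
- by rewrite PhiM.
- by rewrite PhiZ.
- by exists (Cconst _ 1); rewrite Phi1 oner_neq0.
Qed.

(** A point missed by [pi] would have its delta function sent to zero, against injectivity of
    [Phi]. *)
Lemma finite_embedding_pullback (p : {perm T}) (X : compactum)
    (tau : automorphism R X) (Phi : finite_dynamics p -> dynamics tau) :
  embedding Phi ->
  exists pi : X -> T,
    (forall (f : Cfun R finite_compactum) x,
       (Phi f : Cfun R X) x = f (pi x) :> R[i]) /\
    (forall t, exists x, pi x = t).
Proof.
move=> ePhi.
have [||||pi piE] := @finite_hom_pullback X Phi.
- exact: (embedding_add ePhi).
- exact: (embedding_mul ePhi).
- exact: (embedding_scale ePhi).
- exact: (embedding_one ePhi).
exists pi; split=> // t; apply: contrapT => /forallNP tpi.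
have : delta t = Cconst _ 0 :> finite_dynamics p.
  apply: (embedding_inj ePhi); apply: CfunP => x.
  rewrite !piE deltaE evalE.
  by case: eqP => // /tpi.
move=> /(congr1 (fun f : Cfun R finite_compactum => f t : R[i])).
by rewrite deltaE evalE eqxx => /eqP; rewrite oner_eq0.
Qed.

End Space.

Definition finite_pull (T U : finType) (t0 : T) (u0 : U) (g : U -> T)
    (f : Cfun R (finite_compactum t0)) : Cfun R (finite_compactum u0) :=
  finite_fun u0 (fun u => f (g u)).

Lemma finite_pullE (T U : finType) (t0 : T) (u0 : U) (g : U -> T)
    (f : Cfun R (finite_compactum t0)) (u : finite_compactum u0) :
  finite_pull u0 g f u = f (g u) :> R[i].
Proof. by []. Qed.

Lemma finite_pullback (T U : finType) (t0 : T) (u0 : U) (p : {perm T})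
    (q : {perm U}) (g : U -> T) :
  (forall u, g (q u) = p (g u)) -> (forall t, exists u, g u = t) ->
  embedding (finite_pull u0 g : finite_dynamics t0 p -> finite_dynamics u0 q).
Proof.
move=> gq gsurj.
apply: (@pullback_embedding R (finite_compactum u0) (finite_compactum t0)
  (induced_automorphism R (perm_homeo u0 q))
  (induced_automorphism R (perm_homeo t0 p)) _ g) => // f.
by apply: CfunP => u; exact: (congr1 (fun t => f t : R[i]) (esym (gq u))).
Qed.

Lemma finite_embedding_surjection (T U : finType) (t0 : T) (u0 : U)
    (p : {perm T}) (q : {perm U})
    (Phi : finite_dynamics t0 p -> finite_dynamics u0 q) :
  embedding Phi -> exists g : U -> T,
    [/\ forall (f : Cfun R (finite_compactum t0)) u,
          (Phi f : Cfun R (finite_compactum u0)) u = f (g u) :> R[i],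
        forall t, exists u, g u = t & forall u, g (q u) = p (g u)].
Proof.
move=> ePhi; have [g [gE gsurj]] := finite_embedding_pullback ePhi.
exists g; split=> // u.
(* Equivariance is tested on the delta function at [p (g u)]: one side has value 1 at [u], the other
   compares [g (q u)] with [p (g u)]. *)
have /(congr1 (fun f : Cfun R (finite_compactum u0) => f u : R[i])) :=
  embedding_sigma ePhi (delta t0 (p (g u))).
have E : Phi (op_sigma (delta t0 (p (g u)) : finite_dynamics t0 p)) u
   = ((p (g u)) == p (g u))%:R :> R[i] by rewrite gE.
rewrite E.
have -> : (op_sigma (Phi (delta t0 (p (g u)))) : Cfun R (finite_compactum u0)) u =
   (Phi (delta t0 (p (g u))) : Cfun R _) (q u) by [].
by rewrite gE !deltaE eqxx; case: eqP => //= _ /eqP; rewrite oner_eq0.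
Qed.

End FiniteDynamics.

(** * Finite-dimensional algebras of continuous functions *)

Section NormalForm.
Variable R : realType.

Lemma finite_dynamics_member (T : finType) (t0 : T) (p : {perm T}) :
  finite_dimensional_dynamics (finite_dynamics R t0 p).
Proof.
exists (finite_compactum t0), (induced_automorphism R (perm_homeo t0 p)).
split; last first.
  by exists id; split; [exact: embedding_id | exists id].
exists #|T|, (fun i => delta R t0 (enum_val i)) => f.
exists (fun i => f (enum_val i)) => x.
rewrite (bigD1 (enum_rank (x : T)))//= big1 => [|i ix].
  by rewrite addr0 deltaE enum_rankK eqxx mulr1.
rewrite deltaE; case: eqP => [xi|_]; last by rewrite mulr0.
by rewrite xi enum_valK eqxx in ix.
Qed.

Lemma finite_dimensional_dynamics_iso (M N : structure R (cstar_language R)) :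
  isomorphic M N -> finite_dimensional_dynamics N ->
  finite_dimensional_dynamics M.
Proof.
move=> MN [X [tau [fX NX]]]; exists X, tau; split => //.
exact: isomorphic_trans MN NX.
Qed.

(** Urysohn's lemma applied to the finite closed set of the other points and to the singleton of
    [x j]. *)
Lemma compactum_separation (X : compactum) (n : nat) (x : 'I_n -> X) (j : 'I_n) :
  injective x -> exists f : Cfun R X, forall k, f (x k) = (k == j)%:R :> R[i].
Proof.
move=> xinj.
have cl (A : set X) : finite_set A -> closed A.
  have /accessible_finite_set_closed := hausdorff_accessible
    (@compactum_hausdorff X).
  exact.
have nX : normal_space X :=
  compact_normal (@compactum_hausdorff X) (@compactum_compact X).
pose A := x @` [set k | k != j].
have sep : uniform_separator A [set x j].
  apply: ((@normal_separatorP R X).1 nX).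
  - by apply: cl; apply: finite_image; exact: finite_finset.
  - by apply: cl; exact: finite_set1.
  - by rewrite -subset0 => _ [[k /= kj <-] /xinj] /eqP; rewrite (negPf kj).
have [f [fc _ fA fx]] := (@uniform_separatorP _ R _ _).1 sep.
have fcC : continuous ((fun y => (f y)%:C%C) : X -> R[i]^o).
  apply/continuousCP => y e e0.
  have /cvgrPdist_lt/(_ e e0) := fc y.
  by apply: filterS => z; rewrite -rmorphB /= /normc/= expr0n addr0 sqrtr_sqr.
exists (mkcts fcC) => k; change ((f (x k))%:C%C = (k == j)%:R).
have [->|kj] := eqVneq k j.
  by have -> : f (x j) = 1 by apply: fx; exists (x j).
by have -> : f (x k) = 0 by apply: fA; exists (x k) => //; exists k.
Qed.

(** If [n] functions span, then [n.+1] distinct points give separating functions whose evaluation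
    matrix, the identity of size [n.+1], factors through dimension [n]; this contradicts the rank
    bound. *)
Lemma finite_dimensional_finite (X : compactum) :
  finite_dimensional R X -> finite_set [set: X].
Proof.
move=> [n [b bP]]; have [x0] := compactum_inhabited X.
apply: contrapT => /(@infinite_set_fset _ _ n.+1)[B _ nB].
pose x (i : 'I_n.+1) := nth x0 (finmap.enum_fset B) i.
have xinj : injective x.
  move=> i j /eqP; rewrite nth_uniq ?finmap.fset_uniq ?(leq_trans (ltn_ord _))//.
  by move=> /eqP/val_inj.
pose f j := sval (cid (compactum_separation j xinj)).
have fE j k : f j (x k) = (k == j)%:R :> R[i].
  by rewrite /f; case: cid => g gE; exact: (gE k).
have /choice[c cE] := fun j => bP (f j).
pose A : 'M[R[i]]_(n, n.+1) := \matrix_(i, k) (b i (x k) : R[i]).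
pose C : 'M[R[i]]_(n.+1, n) := \matrix_(j, i) c j i.
have CA : C *m A = 1%:M.
  apply/matrixP => j k; rewrite !mxE.
  under eq_bigr do rewrite !mxE.
  by rewrite eq_sym -fE cE.
have := mxrankM_maxr C A; rewrite CA mxrank1 => /leq_trans/(_ (rank_leq_row A)).
by rewrite ltnn.
Qed.

Lemma finite_compactum_discrete (X : compactum) (Y : topologicalType)
  (f : X -> Y) : finite_set [set: X] -> continuous f.
Proof.
move=> fX x; apply: cvg_near_cst.
have cl : closed (~` [set x]).
  have /accessible_finite_set_closed := hausdorff_accessible
    (@compactum_hausdorff X).
  by apply; exact: sub_finite_set fX.
have : nbhs x [set x].
  apply: open_nbhs_nbhs; split => //.
  by rewrite -[X in open X]setCK; exact: closed_openC.
by apply: filterS => y ->.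
Qed.

(** After enumerating the points, duality presents the transported automorphism as composition with
    a self-map [pi] of the index set, which is injective because [tau] is onto. *)
Lemma finite_compactum_dynamics (X : compactum) (tau : automorphism R X) :
  finite_set [set: X] ->
  exists n (p : {perm 'I_n.+1}), isomorphic (dynamics tau) (finite_dynamics R ord0 p).
Proof.
move=> fX; have [x0] := compactum_inhabited X.
have /finite_seqP[s0 s0X] := fX; pose s := undup s0.
have sP x : x \in s by rewrite mem_undup; have : [set: X] x by []; rewrite s0X.
have [n sn] : exists n, size s = n.+1.
  by exists (size s).-1; rewrite prednK // -has_predT; apply/hasP; exists x0.
exists n; pose h (i : 'I_n.+1) := nth x0 s i.
pose k x : 'I_n.+1 := inord (index x s).
have kK : cancel k h.
  by move=> x; rewrite /h /k inordK ?nth_index// -sn index_mem.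
have hK : cancel h k.
  move=> i; rewrite /h /k index_uniq ?undup_uniq ?sn//.
  by rewrite inord_val.
pose F := @finite_compactum 'I_n.+1 ord0.
pose Res (f : Cfun R X) : Cfun R F := finite_fun ord0 (fun i => f (h i)).
pose Ext (f : Cfun R F) : Cfun R X :=
  mkcts (finite_compactum_discrete (f := (fun x => f (k x)) : X -> R[i]^o) fX).
have ResK : cancel Res Ext.
  by move=> f; apply: CfunP => x; exact: (congr1 (fun x => f x : R[i]) (kK x)).
have ExtK : cancel Ext Res.
  by move=> f; apply: CfunP => x; exact: (congr1 (fun x => f x : R[i]) (hK x)).
have [||||pi piE] := @finite_hom_pullback R _ ord0 F (Res \o tau \o Ext).
- move=> f g; have E : Ext (Cadd f g) = Cadd (Ext f) (Ext g) by exact: CfunP.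
  by rewrite /= E aut_add; exact: CfunP.
- move=> f g; have E : Ext (Cmul f g) = Cmul (Ext f) (Ext g) by exact: CfunP.
  by rewrite /= E aut_mul; exact: CfunP.
- move=> c f; have E : Ext (Cscale c f) = Cscale c (Ext f) by exact: CfunP.
  by rewrite /= E aut_scale; exact: CfunP.
- have E : Ext (Cconst F 1) = Cconst X 1 by exact: CfunP.
  by rewrite /= E aut_one; exact: CfunP.
have pi_inj : injective pi.
  move=> i j pij.
  (* The delta function at [i] is the image of some [d], so its values factor through [pi]; equal
     values of [pi] at [i] and [j] then force [i = j]. *)
  have [tau' _ tauK] := aut_bijective tau.
  have : delta R ord0 i i = delta R ord0 i j :> R[i].
    pose d := Res (tau' (Ext (delta R ord0 i))).
    have dE : Res (tau (Ext d)) = delta R ord0 i by rewrite ResK tauK ExtK.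
    have E l : delta R ord0 i l = d (pi l) :> R[i] by rewrite -piE -dE.
    by rewrite !E pij.
  by rewrite !deltaE eqxx; case: eqP => // _ /eqP; rewrite oner_eq0.
exists (perm pi_inj); apply: isomorphic_sym; exists Ext.
apply: embedding_isomorphism; last by move=> f; exists (Res f).
apply: (@pullback_embedding R X F tau
  (induced_automorphism R (perm_homeo ord0 (perm pi_inj))) _ k) => //.
- by move=> i; exists (h i).
- move=> f; rewrite -[RHS]ResK; congr Ext; apply: CfunP => i.
  rewrite piE; exact: (congr1 (fun x => f x : R[i]) (permE pi_inj i)).
Qed.

Lemma finite_dimensional_dynamicsP (M : structure R (cstar_language R)) :
  finite_dimensional_dynamics M <->
  exists n (p : {perm 'I_n.+1}), isomorphic M (finite_dynamics R ord0 p).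
Proof.
split=> [[X [tau [/finite_dimensional_finite fX MX]]]|[n [p Mp]]].
  have [n [p Xp]] := finite_compactum_dynamics tau fX.
  by exists n, p; exact: isomorphic_trans MX Xp.
apply: finite_dimensional_dynamics_iso Mp _; exact: finite_dynamics_member.
Qed.

End NormalForm.

(** * The Fraisse class axioms *)

Section FraisseClass.
Variable R : realType.
Implicit Types M N A B C : structure R (cstar_language R).

Lemma member_finitely_generated A :
  finite_dimensional_dynamics A -> finitely_generated A.
Proof.
move=> /finite_dimensional_dynamicsP[n [p /isomorphic_sym[g [eg [g' g'K gK]]]]].
exists n.+1, (fun i => g (delta R ord0 i)) => S [_ Sinterp] Sg.
apply/seteqP; split=> // x _; rewrite -(gK x).
elim/finite_fun_ind: (g' x) => [|f h Sf Sh|c f Sf|//].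
- rewrite (embedding_zero eg); apply: Sinterp; case.
  by [].
- rewrite (embedding_add eg); apply: Sinterp => i.
  by rewrite /pair2; case: ifP.
- by rewrite (embedding_scale eg); exact: Sinterp.
Qed.

(** * Heredity: subalgebras as quotients of the finite space *)

Section Subdynamics.
Variables (T : finType) (t0 : T) (p : {perm T}) (B : structure R (cstar_language R)).
Variable phi : B -> finite_dynamics R t0 p.
Hypothesis ephi : embedding phi.

Let V (f : Cfun R (finite_compactum t0)) := exists b, phi b = f.

Let V_add f g : V f -> V g -> V (Cadd f g).
Proof. by move=> [b <-] [c <-]; exists (op_add b c); exact: embedding_add. Qed.

Let V_mul f g : V f -> V g -> V (Cmul f g).
Proof. by move=> [b <-] [c <-]; exists (op_mul b c); exact: embedding_mul. Qed.

Let V_scale c f : V f -> V (Cscale c f).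
Proof. by move=> [b <-]; exists (op_scale c b); exact: embedding_scale. Qed.

Let V_const c : V (Cconst _ c).
Proof.
have -> : Cconst _ c = Cscale c (Cconst _ 1) :> Cfun R (finite_compactum t0).
  by apply: CfunP => t; rewrite !evalE mulr1.
by apply: V_scale; exists (op_one B); exact: embedding_one.
Qed.

(** Two points are related when the image of [phi] does not separate them; the classes will be the
    points of the finite space dual to [B]. *)
Let rl (t u : T) : bool := `[< forall b, phi b t = phi b u :> R[i] >].

Let rlP t u : reflect (forall b, phi b t = phi b u :> R[i]) (rl t u).
Proof. exact: asboolP. Qed.

Let rl_refl t : rl t t. Proof. exact/rlP. Qed.

Let rl_eq t u : rl t u -> rl t =1 rl u.
Proof. by move=> /rlP tu v; apply/rlP/rlP => H b; [rewrite -tu|rewrite tu]. Qed.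

Let rl_perm t u : rl t u -> rl (p t) (p u).
Proof.
move=> /rlP tu; apply/rlP => b.
have := tu (op_sigma b); rewrite (embedding_sigma ephi); exact.
Qed.

(** A canonical representative of the class of [t]: related points give the same predicate to
    [pick]. The default [t0] is never reached, by reflexivity. *)
Let c t := odflt t0 [pick u | rl t u].

Let rlc t : rl t (c t).
Proof. by rewrite /c; case: pickP => // /(_ t); rewrite rl_refl. Qed.

Let c_eq t u : rl t u -> c t = c u.
Proof. by move=> /rl_eq tu; rewrite /c (eq_pick tu). Qed.

Let c_rl t u : c t = c u -> rl t u.
Proof.
move=> ctu; have /rlP uc := rlc u; have /rlP tc := rlc t.
by apply/rlP => b; rewrite uc tc ctu.
Qed.

Let cc t : c (c t) == c t.
Proof. by apply/eqP/esym/c_eq; exact: rlc. Qed.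

Let Q : finType := {t : T | c t == t}.
Let pi t : Q := exist _ (c t) (cc t).

Let pi_val (x : Q) : pi (val x) = x.
Proof. by apply: val_inj => /=; exact/eqP/(valP x). Qed.

Let pi_eq t u : rl t u -> pi t = pi u.
Proof. by move=> tu; apply: val_inj; exact: c_eq. Qed.

Let q_fun (x : Q) : Q := pi (p (val x)).

Let pi_equiv t : pi (p t) = q_fun (pi t).
Proof. by apply: pi_eq; apply: rl_perm; exact: rlc. Qed.

(** The inverse permutation induces a right inverse of [q_fun], which is two-sided because [Q] is
    finite. *)
Let q_inj : injective q_fun.
Proof.
pose s (x : Q) := pi ((p^-1)%g (val x)).
have sK : cancel s q_fun by move=> x; rewrite /s -pi_equiv permKV pi_val.
exact: can_inj (canF_sym sK).
Qed.

(** A finite Stone-Weierstrass argument: for each point [u] of [s] separated from [t] by some [g] in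
    [V], multiply by the affine function of [g] that is 1 at [t] and 0 at [u]. *)
Let V_indicator_seq t (s : seq T) :
  exists2 f, V f & f t = 1 :> R[i] /\
    forall u, u \in s -> ~~ rl t u -> f u = 0 :> R[i].
Proof.
elim: s => [|u s [f Vf [ft fs]]]; first by exists (Cconst _ 1).
have [tu|tu] := boolP (rl t u).
  exists f => //; split=> // v; rewrite inE => /predU1P[->|/fs//].
  by rewrite tu.
have [g Vg gtu] : exists2 g, V g & g t != g u :> R[i].
  move: tu => /asboolPn/existsNP[b /eqP btu].
  by exists (phi b); [exists b|].
pose d : R[i] := (g t - g u)^-1.
exists (Cmul f (Cscale d (Cadd g (Cconst _ (- (g u : R[i])))))).
  by apply: V_mul => //; apply: V_scale; apply: V_add.
split.
  by rewrite !evalE ft mul1r mulVf// subr_eq0.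
move=> v; rewrite inE !evalE => /predU1P[->|vs] tv.
  by rewrite subrr !mulr0.
by rewrite fs// mul0r.
Qed.

Let V_indicator t : V (finite_fun t0 (fun u => (rl t u)%:R)).
Proof.
have [f Vf [ft fs]] := V_indicator_seq t (enum T).
suff -> : finite_fun t0 (fun u => (rl t u)%:R) = f by [].
apply: CfunP => u; rewrite finite_funE.
have [tu|tu] := boolP (rl t u); last by rewrite fs ?mem_enum.
by rewrite -ft; case: Vf => b <-; move/rlP: tu; exact.
Qed.

(** Pulling functions back from the quotient [Q] has exactly [V] as image: class indicators lie in
    [V], and members of [V] are constant on classes. Hence [B] is isomorphic to the dynamics of [q]
    on [Q]. *)
Lemma finite_subdynamics : finite_dimensional_dynamics B.
Proof.
pose q := perm q_inj; pose x0 := pi t0.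
have pi_q t : pi (p t) = q (pi t) by rewrite permE pi_equiv.
have pi_surj x : exists t, pi t = x by exists (val x).
have erho := finite_pullback R x0 t0 pi_q pi_surj.
set rho := (X in embedding X) in erho.
have Vrho (f : Cfun R (finite_compactum x0)) : V (rho f).
  elim/finite_fun_ind: f => [|f g Vf Vg|a f Vf|x].
  - by rewrite (embedding_zero erho); exact: V_const.
  - by rewrite (embedding_add erho); exact: V_add.
  - by rewrite (embedding_scale erho); exact: V_scale.
  - have -> : rho (delta R x0 x) = finite_fun t0 (fun u => (rl (val x) u)%:R).
      apply: CfunP => t; rewrite finite_pullE deltaE finite_funE.
      congr ((nat_of_bool _)%:R).
      apply/eqP/idP => [<-|/pi_eq <-]; last exact: pi_val.
      by apply: c_rl; exact/eqP/cc.
    exact: V_indicator.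
have [|psi epsi psiE] := factor_embedding ephi erho.
  move=> b; exists (finite_fun x0 (fun x => phi b (val x))).
  by apply: CfunP => t; rewrite finite_pullE finite_funE; apply/esym/rlP; exact: rlc.
apply: finite_dimensional_dynamics_iso (finite_dynamics_member R x0 q).
exists psi; apply: embedding_isomorphism => // f.
have [b bf] := Vrho f; exists b.
by apply: (embedding_inj erho); rewrite psiE.
Qed.

End Subdynamics.

Lemma member_hereditary : hereditary (@finite_dimensional_dynamics R).
Proof.
move=> A B phi /finite_dimensional_dynamicsP[n [p [f [ef _]]]] ephi _.
exact: (finite_subdynamics (embedding_comp ef ephi)).
Qed.

End FraisseClass.

(** * Amalgamation and joint embedding *)

Section Amalgamation.
Variable R : realType.
Implicit Types M N A B C : structure R (cstar_language R).

Section FiberProduct.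
Variables (T U0 U1 : finType) (p : {perm T}) (p0 : {perm U0}) (p1 : {perm U1}).
Variables (g0 : U0 -> T) (g1 : U1 -> T).
Hypothesis g0p : forall u, g0 (p0 u) = p (g0 u).
Hypothesis g1p : forall u, g1 (p1 u) = p (g1 u).

Definition fiber_product : finType := {x : U0 * U1 | g0 x.1 == g1 x.2}.

Lemma fiber_perm_subproof (x : fiber_product) :
  g0 (p0 (val x).1) == g1 (p1 (val x).2).
Proof. by rewrite g0p g1p (eqP (valP x)). Qed.

Definition fiber_fun (x : fiber_product) : fiber_product :=
  exist _ (p0 (val x).1, p1 (val x).2) (fiber_perm_subproof x).

Lemma fiber_fun_inj : injective fiber_fun.
Proof.
move=> x y [/perm_inj xy0 /perm_inj xy1]; apply: val_inj.
by rewrite (surjective_pairing (val x)) xy0 xy1 -surjective_pairing.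
Qed.

Definition fiber_perm : {perm fiber_product} := perm fiber_fun_inj.

End FiberProduct.

(** The amalgam is dual to the fiber product of the two surjections; surjectivity of each makes the
    opposite projection surjective. *)
Lemma finite_amalgamation (T U0 U1 : finType) (t0 : T) (u0 : U0) (u1 : U1)
    (p : {perm T}) (p0 : {perm U0}) (p1 : {perm U1})
    (phi0 : finite_dynamics R t0 p -> finite_dynamics R u0 p0)
    (phi1 : finite_dynamics R t0 p -> finite_dynamics R u1 p1) :
  embedding phi0 -> embedding phi1 ->
  exists C (psi0 : finite_dynamics R u0 p0 -> C)
    (psi1 : finite_dynamics R u1 p1 -> C),
    [/\ finite_dimensional_dynamics C, embedding psi0, embedding psi1 &
        psi0 \o phi0 =1 psi1 \o phi1].
Proof.
move=> /finite_embedding_surjection[g0 [phi0E g0s g0p]].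
move=> /finite_embedding_surjection[g1 [phi1E g1s g1p]].
have s0 u : exists x : fiber_product g0 g1, (val x).1 = u.
  have [v gv] := g1s (g0 u); have uv : g0 u == g1 v by rewrite gv.
  by exists (exist _ (u, v) uv).
have s1 u : exists x : fiber_product g0 g1, (val x).2 = u.
  have [v gv] := g0s (g1 u); have uv : g0 v == g1 u by rewrite gv.
  by exists (exist _ (v, u) uv).
have [x0 _] := s0 u0; pose q := fiber_perm g0p g1p.
have e0 : forall x, (val (q x)).1 = p0 (val x).1 by move=> x; rewrite permE.
have e1 : forall x, (val (q x)).2 = p1 (val x).2 by move=> x; rewrite permE.
exists (finite_dynamics R x0 q), (finite_pull x0 (fun x => (val x).1)),
  (finite_pull x0 (fun x => (val x).2)); split.
- exact: finite_dynamics_member.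
- exact: (finite_pullback R u0 x0 e0 s0).
- exact: (finite_pullback R u1 x0 e1 s1).
- move=> f; apply: CfunP => x.
  have := phi0E f (val x).1; rewrite (eqP (valP x)) -phi1E; exact.
Qed.

Lemma member_amalgamation : amalgamation (@finite_dimensional_dynamics R).
Proof.
move=> A B0 B1 phi0 phi1 /finite_dimensional_dynamicsP[n [p Ap]].
move=> /finite_dimensional_dynamicsP[n0 [p0 [h0 [eh0 _]]]].
move=> /finite_dimensional_dynamicsP[n1 [p1 [h1 [eh1 _]]]] e0 e1.
have [g [eg [g' _ gK]]] := isomorphic_sym Ap.
have [C [psi0 [psi1 [KC epsi0 epsi1 psiE]]]] := finite_amalgamation
  (embedding_comp eh0 (embedding_comp e0 eg))
  (embedding_comp eh1 (embedding_comp e1 eg)).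
exists C, (psi0 \o h0), (psi1 \o h1); split => //.
- exact: embedding_comp.
- exact: embedding_comp.
- by move=> a; rewrite -(gK a); exact: psiE.
Qed.

(** The complex numbers with the identity automorphism; they embed in every member, so joint
    embedding is amalgamation over them. *)
Definition one_point_dynamics := finite_dynamics R (ord0 : 'I_1) 1%g.

Lemma one_point_initial A : finite_dimensional_dynamics A ->
  exists phi : one_point_dynamics -> A, embedding phi.
Proof.
move=> /finite_dimensional_dynamicsP[n [p /isomorphic_sym[g [eg _]]]].
have e : forall i : 'I_n.+1, ord0 = (1%g : {perm 'I_1}) ord0 by rewrite perm1.
have s : forall i : 'I_1, exists j : 'I_n.+1, ord0 = i.
  by move=> i; exists ord0; exact/esym/ord1.
have := finite_pullback R (ord0 : 'I_1) (ord0 : 'I_n.+1)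
  (p := 1%g) (q := p) (g := fun=> ord0) e s.
move=> /(embedding_comp eg) ?.
by exists (g \o finite_pull ord0 (fun=> ord0)).
Qed.

Lemma member_joint_embedding : joint_embedding (@finite_dimensional_dynamics R).
Proof.
move=> A B KA KB.
have [phi ephi] := one_point_initial KA; have [psi epsi] := one_point_initial KB.
have K1 : finite_dimensional_dynamics one_point_dynamics.
  exact: finite_dynamics_member.
have [C [f [g [KC ef eg _]]]] := member_amalgamation K1 KA KB ephi epsi.
by exists C, f, g.
Qed.

End Amalgamation.

(** * Cauchy continuity of the symbols *)

Section CauchyContinuity.
Variable R : realType.
Implicit Types M : structure R (cstar_language R).

Definition op_norm M (x : M) : R := mdist x (op_zero M).

Lemma embedding_norm M (N : structure R (cstar_language R)) (f : M -> N) x :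
  embedding f -> op_norm (f x) = op_norm x.
Proof. by move=> ef; rewrite /op_norm -(embedding_zero ef) (ef.1 x). Qed.

(** On a ball of given radius the modulus of continuity depends neither on the space nor on the
    automorphism. The bound matters only for multiplication. *)
Lemma dynamics_interp_uniform (s : cstar_symbol R) (B e : R) : 0 < e ->
  exists2 d : R, 0 < d & forall (X : compactum) (tau : automorphism R X)
    (a b : 'I_(cstar_arity s) -> dynamics tau),
    (forall i, op_norm (a i) <= B) -> (forall i, op_norm (b i) <= B) ->
    (forall i, mdist (a i) (b i) < d) ->
    mdist (interp (s := s : symbol (cstar_language R)) a)
      (interp (s := s : symbol (cstar_language R)) b) < e.
Proof.
move=> e0; case: s => [||||| c|].
- by exists 1 => // X tau a b _ _ _; rewrite mdistxx.
- by exists 1 => // X tau a b _ _ _; rewrite mdistxx.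
- exists (e / 2); first by rewrite divr_gt0.
  move=> X tau a b _ _ ab; apply: le_lt_trans (Cadd_dist _ _ _ _) _.
  by rewrite (splitr e) ltrD// ab.
- pose B' := `|B| + 1.
  have B'0 : 0 < B' by rewrite ltr_wpDl.
  exists (e / (B' + B')); first exact: divr_gt0 e0 (addr_gt0 B'0 B'0).
  move=> X tau a b aB bB ab; apply: le_lt_trans (Cmul_dist _ _ _ _) _.
  have BB' : B <= B' by rewrite (le_trans (ler_norm _))// lerDl.
  apply: (@lt_le_trans _ _ (e / (B' + B') * B' + B' * (e / (B' + B')))); last first.
    by rewrite [X in X + _]mulrC -mulrDl mulrC divfK// gt_eqF// addr_gt0.
  apply: (@le_lt_trans _ _
    (Cdist (a ord0) (b ord0) * B' + B' * Cdist (a ord_max) (b ord_max))).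
    apply: lerD.
      by apply: ler_wpM2l; [exact: Cdist_ge0|exact: (le_trans (aB ord_max) BB')].
    by apply: ler_wpM2r; [exact: Cdist_ge0|exact: (le_trans (bB ord0) BB')].
  by rewrite ltrD// ?ltr_pM2l ?ltr_pM2r//; exact: ab.
- by exists e => // X tau a b _ _ ab; exact: le_lt_trans (Cstar_dist _ _) (ab _).
- pose c' := normc c + 1.
  have c'0 : 0 < c' by rewrite ltr_wpDl// normc_ge0.
  exists (e / c'); first by rewrite divr_gt0.
  move=> X tau a b _ _ ab; apply: (@le_lt_trans _ _ (c' * Cdist (a ord0) (b ord0))).
    apply: Cdist_le => x; rewrite !evalE -mulrBr ComplexField.Normc.normcM.
    by apply: ler_pM; rewrite ?normc_ge0 ?lerDl//; exact: Cdist_ub.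
  by rewrite mulrC -ltr_pdivlMr//; exact: ab.
- by exists e => // X tau a b _ _ ab; exact: le_lt_trans (aut_contraction _ _ _) (ab _).
Qed.

Lemma member_cauchy_continuity :
  cauchy_continuity (@finite_dimensional_dynamics R).
Proof.
move=> n p _ pc s v e e0.
have [N0 pN0] := pc 1 ltr01.
pose nrm k i := op_norm (projT2 (p k) i).
(* From stage [N0] on, every entry lies within 1 of the corresponding entry at [N0] in a common
   extension, so [B] bounds all later norms. *)
pose B := \sum_i nrm N0 i + 1.
have nrm0 k i : 0 <= nrm k i by exact: mdist_ge0.
have nB k i : (N0 <= k)%N -> nrm k i <= B.
  move=> /pN0/(_ (leqnn _))[C [phi [psi [_ ephi epsi]]]] /(_ i) d1.
  rewrite /nrm -(embedding_norm _ ephi).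
  apply: le_trans (metric_triangle _ (psi (projT2 (p N0) i)) _) _.
  rewrite addrC lerD ?(ltW d1)//.
  rewrite -/(op_norm _) (embedding_norm _ epsi) -/(nrm _ _) (bigD1 i)//=.
  by rewrite lerDl sumr_ge0.
have [d d0 dP] := dynamics_interp_uniform s B e0.
(* The bound [d] serves the new value of the symbol, the bound [e] the entries already present. *)
have de0 : 0 < Num.min d e by rewrite lt_min d0.
have [N1 pN1] := pc _ de0.
exists (maxn N0 N1) => j k; rewrite !geq_max => /andP[j0 j1] /andP[k0 k1].
have [C [phi [psi [KC ephi epsi d1]]]] := pN1 j k j1 k1.
have [X [tau [fX [h [eh bh]]]]] := KC.
have e1 := embedding_comp eh ephi; have e2 := embedding_comp eh epsi.
exists (dynamics tau), (h \o phi), (h \o psi); split=> //.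
  by exists X, tau; split=> //; exists id; split; [exact: embedding_id|exists id].
have dd i : mdist ((h \o phi) (projT2 (p j) i)) ((h \o psi) (projT2 (p k) i)) <
    Num.min d e.
  by rewrite /= eh.1.
case=> [i|] /=.
  by have := dd i; rewrite lt_min => /andP[].
have := e1.2 s (projT2 (p j) \o v); have := e2.2 s (projT2 (p k) \o v).
move=> /= -> ->; apply: dP => i.
- by rewrite [_ i]/= (embedding_norm _ e1); exact: nB.
- by rewrite [_ i]/= (embedding_norm _ e2); exact: nB.
- by have := dd (v i); rewrite lt_min => /andP[].
Qed.

End CauchyContinuity.

(** * Separability of the class *)

Section Rational.
Variable R : realType.

Definition ratC (q : rat * rat) : R[i] := (ratr q.1 +i* ratr q.2)%C.

Lemma ratC_dense (z : R[i]) (e : R) : 0 < e -> exists q, normc (z - ratC q) < e.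
Proof.
move=> e0; have e20 : 0 < e / 2 by rewrite divr_gt0.
have D (x : R) : exists q, `|x - ratr q| < e / 2.
  have [|q] := @rat_in_itvoo R (x - e / 2) (x + e / 2).
    by rewrite ltrD2l gt0_cp.
  rewrite in_itv /= => /andP[xq qx]; exists q.
  by rewrite ltr_distlC xq.
have [q1 d1] := D (complex.Re z); have [q2 d2] := D (complex.Im z).
exists (q1, q2); apply: le_lt_trans (normc_ReIm _) _.
by rewrite (splitr e) !raddfB /= ltrD.
Qed.

End Rational.

Section WeakPolish.
Variable R : realType.
Implicit Types M : structure R (cstar_language R).

(** A generated member is coded by a permutation, a rational approximation of the matrix of values
    of its tuple, and a rational error. Two members sharing a code embed in the same finite algebra
    within twice that error. *)
Lemma member_weak_polish : weak_polish (@finite_dimensional_dynamics R).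
Proof.
move=> n.
pose J0 : countType := ({m : nat &
  ({perm 'I_m.+1} * {ffun 'I_n * 'I_m.+1 -> rat * rat})%type} * rat)%type.
pose close (j : J0) (q : tupled R (cstar_language R) 'I_n) :=
  exists phi : projT1 q -> finite_dynamics R ord0 (projT2 j.1).1,
    embedding phi /\ forall i t,
      normc ((phi (projT2 q i) : Cfun R (finite_compactum ord0)) t
        - ratC R ((projT2 j.1).2 (i, t)) : R[i]) < ratr j.2.
(* Only realized codes are kept, each with a chosen realization: the rational tuple itself need not
   generate. *)
pose J : countType := {j : J0 | `[< exists q,
  generated_member (@finite_dimensional_dynamics R) q /\ close j q >]}.
have DP (j : J) := cid (asboolW (valP j)).
exists J, (fun j => sval (DP j)); split.
  by move=> j; case: (DP j) => q [].
move=> p pgen e e0.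
have [m [s [phi [ephi _]]]] := (finite_dimensional_dynamicsP _).1 pgen.1.
have [|d] := @rat_in_itvoo R 0 (e / 2); first by rewrite divr_gt0.
rewrite in_itv /= => /andP[d0 de].
have /choice[r rP] : forall x : 'I_n * 'I_m.+1, exists q,
    normc ((phi (projT2 p x.1) : Cfun R (finite_compactum ord0)) x.2
      - ratC R q : R[i]) < ratr d.
  by move=> x; exact: ratC_dense.
pose j0 : J0 := (existT _ m (s, [ffun x => r x]), d).
have j0p : close j0 p.
  by exists phi; split=> // i t; rewrite /= ffunE; exact: (rP (i, t)).
have j0J : `[< exists q,
    generated_member (@finite_dimensional_dynamics R) q /\ close j0 q >].
  by apply/asboolP; exists p.
exists (exist _ j0 j0J : J).
case: (DP _) => q [qgen [psi [epsi psiP]]] /=.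
exists (finite_dynamics R ord0 s), phi, psi; split => //.
  exact: finite_dynamics_member.
move=> i; apply: (@le_lt_trans _ _ (ratr d + ratr d)); last first.
  by rewrite (splitr e) ltrD.
apply: Cdist_le => t; apply: le_trans (normc_dist _ (ratC R (r (i, t))) _) _.
apply: lerD; first exact: ltW (rP (i, t)).
by rewrite normcBC ltW//; have := psiP i t; rewrite /= ffunE.
Qed.

Theorem finite_dimensional_fraisse_class :
  fraisse_class (@finite_dimensional_dynamics R).
Proof.
split.
- exact: member_finitely_generated.
- exact: member_hereditary.
- exact: member_joint_embedding.
- exact: member_amalgamation.
- exact: member_weak_polish.
- exact: member_cauchy_continuity.
Qed.

End WeakPolish.

(** * Back-and-forth *)

Section DensePartialIsomorphism.
Variables (R : realType) (L : language).
Implicit Types M N : structure R L.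

Definition partial_isometry M N (G : M -> N -> Prop) :=
  forall x x' y y', G x y -> G x' y' -> mdist x x' = mdist y y'.

(** The closure of the relation [G] in the product of [M] and [N]. *)
Definition pair_closure M N (G : M -> N -> Prop) (x : M) (y : N) :=
  forall e : R, 0 < e -> exists a b, [/\ G a b, mdist a x < e & mdist b y < e].

Lemma pair_closure_subset M N (G : M -> N -> Prop) x y :
  G x y -> pair_closure G x y.
Proof. by move=> Gxy e e0; exists x, y; rewrite !mdistxx. Qed.

Lemma pair_closure_flip M N (G : M -> N -> Prop) x y :
  pair_closure (fun y x => G x y) y x -> pair_closure G x y.
Proof. by move=> cxy e /cxy[a [b [Gab ax bx]]]; exists b, a. Qed.

Lemma pair_closure_le M N (G : M -> N -> Prop) : partial_isometry G ->
  forall x x' y y', pair_closure G x y -> pair_closure G x' y' ->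
    mdist x x' <= mdist y y'.
Proof.
move=> iG x x' y y' cxy cxy'; apply/ler_addgt0Pl => e e0.
(* Four approximation errors occur, one for each of [x], [x'], [y] and [y']. *)
have e4 : 0 < e / 4 by rewrite divr_gt0.
have [a [b [Gab ax bx]]] := cxy _ e4.
have [a' [b' [Gab' ax' bx']]] := cxy' _ e4.
have D := iG _ _ _ _ Gab Gab'.
have T1 := metric_triangle x a x'; have T2 := metric_triangle a a' x'.
have T3 := metric_triangle b y b'; have T4 := metric_triangle y y' b'.
rewrite (metric_sym x a) in T1; rewrite (metric_sym y' b') in T4.
lra.
Qed.

Lemma pair_closure_isometry M N (G : M -> N -> Prop) : partial_isometry G ->
  partial_isometry (pair_closure G).
Proof.
move=> iG x x' y y' cxy cxy'; apply/eqP; rewrite eq_le.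
rewrite (pair_closure_le iG cxy cxy') andTb.
apply: (@pair_closure_le N M (fun y x => G x y)) => [? ? ? ? G1 G2||].
- by rewrite (iG _ _ _ _ G1 G2).
- exact: pair_closure_flip.
- exact: pair_closure_flip.
Qed.

(** Approximants of [x] form a Cauchy sequence, hence so do their partners, by isometry;
    completeness of [N] supplies the limit [y]. *)
Lemma pair_closure_total M N (G : M -> N -> Prop) : partial_isometry G ->
  (forall x (e : R), 0 < e -> exists a b, G a b /\ mdist a x < e) ->
  forall x, exists y, pair_closure G x y.
Proof.
move=> iG dG x.
have /choice[ab abP] : forall n : nat, exists ab : M * N,
    G ab.1 ab.2 /\ mdist ab.1 x < n.+1%:R^-1.
  by move=> n; have [a [b [Gab ax]]] := dG x n.+1%:R^-1 ltac:(by rewrite invr_gt0);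
     exists (a, b).
have small (e : R) : 0 < e -> exists n0, forall n, (n0 <= n)%N ->
    mdist (ab n).1 x < e.
  move=> e0; have [n0 _ n0P] := near_infty_natSinv_lt (PosNum e0).
  by exists n0 => n /n0P /=; apply: lt_trans; have [] := abP n.
have [|y yP] := @carrier_complete R L N (fun n => (ab n).2).
  apply/cauchy_ballP => e e0; have [n0 n0P] := small (e / 2) ltac:(by rewrite divr_gt0).
  rewrite near_map2 /=.
  exists ([set k | (n0 <= k)%N], [set k | (n0 <= k)%N]).
    by split; exists n0.
  move=> [j k] /= [/n0P dj /n0P dk]; rewrite ballEmdist /=.
  have [Gj _] := abP j; have [Gk _] := abP k.
  rewrite -(iG _ _ _ _ Gj Gk) (le_lt_trans (metric_triangle _ x _))//.
  by rewrite (splitr e) ltrD// metric_sym.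
exists y => e e0; have [n0 n0P] := small e e0.
have [n1 _ n1P] := (cvg_ballP _ _).1 yP e e0.
have /n0P d0 := leq_maxl n0 n1; have := n1P _ (leq_maxr n0 n1).
rewrite /= ballEmdist /= => d1.
exists (ab (maxn n0 n1)).1, (ab (maxn n0 n1)).2; split=> //.
  by have [] := abP (maxn n0 n1).
by rewrite metric_sym.
Qed.

(** The closure of [G] is the graph of an isometry, total and onto by density on both sides;
    compatibility with the symbols passes to the closure by continuity. *)
Lemma dense_partial_isomorphism M N (G : M -> N -> Prop) :
  partial_isometry G ->
  (forall (s : symbol L) (a : 'I_(arity s) -> M) (b : 'I_(arity s) -> N),
     (forall i, G (a i) (b i)) -> G (interp a) (interp b)) ->
  (forall x (e : R), 0 < e -> exists a b, G a b /\ mdist a x < e) ->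
  (forall y (e : R), 0 < e -> exists a b, G a b /\ mdist b y < e) ->
  exists2 alpha : M -> N, isomorphism alpha & forall x y, G x y -> alpha x = y.
Proof.
move=> iG opG dl dr.
have iC := pair_closure_isometry iG.
have /choice[alpha alphaP] := pair_closure_total iG dl.
have uniq x y : pair_closure G x y -> alpha x = y.
  move=> cxy; apply: mdist_positivity.
  by rewrite -(iC _ _ _ _ (alphaP x) cxy) mdistxx.
exists alpha; last by move=> x y /pair_closure_subset/uniq.
apply: embedding_isomorphism; last first.
  move=> y; have [||x xP] := @pair_closure_total N M (fun y x => G x y) _ _ y.
  - by move=> ? ? ? ? G1 G2; rewrite (iG _ _ _ _ G1 G2).
  - by move=> z e /(dr z)[a [b [Gab bz]]]; exists b, a.
  - by exists x; apply: uniq; exact: pair_closure_flip.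
split=> [x x'|s a]; first by rewrite (iC _ _ _ _ (alphaP x) (alphaP x')).
apply: uniq => e e0.
have [d1 d10 d1P] := interp_continuous a e0.
have [d2 d20 d2P] := interp_continuous (alpha \o a) e0.
have d0 : 0 < Num.min d1 d2 by rewrite lt_min d10.
have /choice[cd cdP] : forall i, exists cd : M * N, [/\ G cd.1 cd.2,
    mdist cd.1 (a i) < Num.min d1 d2 & mdist cd.2 (alpha (a i)) < Num.min d1 d2].
  by move=> i; have [c [d cd]] := alphaP (a i) _ d0; exists (c, d).
exists (interp (fun i => (cd i).1)), (interp (fun i => (cd i).2)); split.
- by apply: opG => i; have [] := cdP i.
- rewrite metric_sym; apply: d1P => i; rewrite metric_sym.
  by have [_] := cdP i; rewrite lt_min => /andP[].
- rewrite metric_sym; apply: d2P => i; rewrite metric_sym.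
  by have [_ _] := cdP i; rewrite lt_min => /andP[].
Qed.

End DensePartialIsomorphism.

(** * Exact back-and-forth between generic structures *)

Section BackAndForth.
Variable R : realType.
Implicit Types M N : structure R (cstar_language R).

(** The form of the limit axioms used by the back-and-forth: the approximating algebra contains the
    given finite-dimensional one exactly, and embeddings extend without error. *)
Record generic M : Prop := Generic {
  generic_separable : exists2 D : set M, countable D & dense D;
  generic_approximation : forall (T : finType) (t0 : T) (p : {perm T})
    (phi : finite_dynamics R t0 p -> M) (x : M) (e : R),
    embedding phi -> 0 < e ->
    exists (U : finType) (u0 : U) (q : {perm U})
      (theta : finite_dynamics R u0 q -> M),
      [/\ embedding theta, forall f, exists g, theta g = phi f &
          exists b, mdist (theta b) x < e];
  generic_extension : forall (T U : finType) (t0 : T) (u0 : U) (p : {perm T})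
    (q : {perm U}) (i : finite_dynamics R t0 p -> finite_dynamics R u0 q)
    (phi : finite_dynamics R t0 p -> M), embedding i -> embedding phi ->
    exists2 psi : finite_dynamics R u0 q -> M, embedding psi &
      forall f, psi (i f) = phi f
}.

(** A partial isomorphism between finite-dimensional subalgebras, kept as a relation so that
    extending it is plain inclusion and exchanging the two sides is immediate. *)
Definition finite_correspondence M N (G : M -> N -> Prop) :=
  exists (T : finType) (t0 : T) (p : {perm T})
    (phi : finite_dynamics R t0 p -> M) (psi : finite_dynamics R t0 p -> N),
    [/\ embedding phi, embedding psi &
        forall x y, G x y <-> exists f, phi f = x /\ psi f = y].

Lemma finite_correspondence_flip M N (G : M -> N -> Prop) :
  finite_correspondence G -> finite_correspondence (fun y x => G x y).
Proof.
move=> [T [t0 [p [phi [psi [ephi epsi GE]]]]]].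
exists T, t0, p, psi, phi; split => // x y; rewrite GE.
by split=> -[f [? ?]]; exists f.
Qed.

(** Approximation in [M] enlarges the domain until it comes near [x]; extension in [N] carries the
    partner embedding along. *)
Lemma correspondence_forth M N (G : M -> N -> Prop) (x : M) (e : R) :
  generic M -> generic N -> finite_correspondence G -> 0 < e ->
  exists G', [/\ finite_correspondence G', forall a b, G a b -> G' a b &
    exists a b, G' a b /\ mdist a x < e].
Proof.
move=> gM gN [T [t0 [p [phi [psi [ephi epsi GE]]]]]] e0.
have [U [u0 [q [theta [etheta phith [b bx]]]]]] :=
  generic_approximation gM x ephi e0.
have [i ei iE] := factor_embedding ephi etheta phith.
have [psi' epsi' psi'E] := generic_extension gN ei epsi.
exists (fun x y => exists f, theta f = x /\ psi' f = y); split.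
- by exists U, u0, q, theta, psi'.
- by move=> y z /GE[f [<- <-]]; exists (i f); rewrite iE psi'E.
- by exists (theta b), (psi' b); split=> //; exists b.
Qed.

Lemma dense_sequence M : (exists2 D : set M, countable D & dense D) ->
  exists d : nat -> M, forall x (e : R), 0 < e -> exists k, mdist (d k) x < e.
Proof.
move=> [D /countable_injP[f finj] dD].
have /choice[d dP] : forall k, exists x, forall y, D y -> f y = k -> y = x.
  move=> k; have [[x [Dx fx]]|H] := pselect (exists x, D x /\ f x = k).
    by exists x => y Dy fy; apply: finj; rewrite ?fx//; exact: mem_set.
  (* Indices outside the range of [f] receive an arbitrary value. *)
  by exists (op_zero M) => y Dy fy; case: H; exists y.
exists d => x e e0.
have [||y [xy Dy]] := dD (ball x e)^°.
- by exists x; exact: nbhsx_ballx.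
- exact: open_interior.
exists (f y); rewrite -(dP _ y)// metric_sym.
by move/interior_subset: xy; rewrite ballEmdist.
Qed.

(** Starting from the correspondence of [phi] and [psi], each stage meets one point of each dense
    sequence at one precision; the union of the stages is a dense partial isomorphism. *)
Theorem back_and_forth M N (T : finType) (t0 : T) (p : {perm T})
    (phi : finite_dynamics R t0 p -> M) (psi : finite_dynamics R t0 p -> N) :
  generic M -> generic N -> embedding phi -> embedding psi ->
  exists2 alpha : M -> N, isomorphism alpha & forall f, alpha (phi f) = psi f.
Proof.
move=> gM gN ephi epsi.
have [dM dMP] := dense_sequence (generic_separable gM).
have [dN dNP] := dense_sequence (generic_separable gN).
pose corr := {G : M -> N -> Prop | finite_correspondence G}.
have stepP (z : corr * (nat * nat)) : exists G' : corr,
    [/\ forall a b, sval z.1 a b -> sval G' a b,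
        exists a b, sval G' a b /\ mdist a (dM z.2.1) < z.2.2.+1%:R^-1 &
        exists a b, sval G' a b /\ mdist b (dN z.2.1) < z.2.2.+1%:R^-1].
  case: z => -[G cG] [j l] /=.
  have e0 : (0 : R) < l.+1%:R^-1 by rewrite invr_gt0.
  have [G1 [cG1 GG1 [a [b [Gab ad]]]]] := correspondence_forth (dM j) gM gN cG e0.
  have [G2 [cG2 GG2 [c [d [Gcd cd]]]]] :=
    correspondence_forth (dN j) gN gM (finite_correspondence_flip cG1) e0.
  exists (exist _ _ (finite_correspondence_flip cG2)); split => /=.
  - by move=> x y /GG1/GG2.
  - by exists a, b; split=> //; exact: GG2.
  - by exists d, c.
have [step stepE] := choice stepP.
have cG0 : finite_correspondence (fun x y => exists f, phi f = x /\ psi f = y).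
  by exists T, t0, p, phi, psi.
pose G0 : corr := exist _ _ cG0.
(* Stage [k] treats the pair of target index and precision coded by [k]; the default pair only fills
   numbers that are not codes. *)
pose dec (k : nat) : nat * nat := odflt (0, 0)%N (unpickle k).
pose chain := fix chain (k : nat) : corr :=
  if k is k'.+1 then step (chain k', dec k') else G0.
have chainS k a b : sval (chain k) a b -> sval (chain k.+1) a b.
  by have [H _ _] := stepE (chain k, dec k); exact: H.
have chain_mono j k a b : (j <= k)%N -> sval (chain j) a b -> sval (chain k) a b.
  move=> /subnK <-; elim: (k - j)%N => // m IH H; rewrite addSn.
  by apply: chainS; exact: IH.
pose G x y := exists k, sval (chain k) x y.
have [||||alpha ialpha alphaE] := @dense_partial_isomorphism _ _ M N G.
- move=> x x' y y' [j Gj] [k Gk].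
  have Hj := chain_mono _ _ _ _ (leq_maxl j k) Gj.
  have Hk := chain_mono _ _ _ _ (leq_maxr j k) Gk.
  case: (chain (maxn j k)) Hj Hk => H [U [u0 [q [f [g [ef eg HE]]]]]] /=.
  by move=> /HE[a [<- <-]] /HE[b [<- <-]]; rewrite ef.1 eg.1.
- move=> s a b Gab; have [k kP] := choice Gab.
  (* A symbol has finitely many arguments, so they all lie in one stage, whose correspondence is
     closed under the symbols. *)
  pose m := \max_i k i; exists m.
  have Hm i : sval (chain m) (a i) (b i).
    by apply: chain_mono (kP i); exact: leq_bigmax.
  case: (chain m) Hm => H [U [u0 [q [f [g [ef eg HE]]]]]] /= Hab.
  have /choice[c cP] := fun i => (HE _ _).1 (Hab i).
  apply/HE; exists (@interp R (cstar_language R) (finite_dynamics R u0 q) s c).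
  rewrite ef.2 eg.2.
  by split; congr interp; apply/funext => i /=; have [] := cP i.
- move=> x e e0; have e20 : 0 < e / 2 by rewrite divr_gt0.
  have [j jx] := dMP x _ e20.
  have [l _ lP] := near_infty_natSinv_lt (PosNum e20).
  have [_ [a [b [Gab ad]]] _] :=
    stepE (chain (pickle (j, l)), dec (pickle (j, l))).
  exists a, b; split; first by exists (pickle (j, l)).+1.
  rewrite (le_lt_trans (metric_triangle _ (dM j) _))// (splitr e) ltrD//.
  move: ad; rewrite /dec pickleK /= => /lt_trans; apply.
  exact: (lP l (leqnn l)).
- move=> y e e0; have e20 : 0 < e / 2 by rewrite divr_gt0.
  have [j jy] := dNP y _ e20.
  have [l _ lP] := near_infty_natSinv_lt (PosNum e20).
  have [_ _ [a [b [Gab ad]]]] :=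
    stepE (chain (pickle (j, l)), dec (pickle (j, l))).
  exists a, b; split; first by exists (pickle (j, l)).+1.
  rewrite (le_lt_trans (metric_triangle _ (dN j) _))// (splitr e) ltrD//.
  move: ad; rewrite /dec pickleK /= => /lt_trans; apply.
  exact: (lP l (leqnn l)).
by exists alpha => // f; apply: alphaE; exists 0%N, f.
Qed.

End BackAndForth.

(** * Rigidity of idempotents in a limit *)

Section Rigidity.
Variables (R : realType) (M : structure R (cstar_language R)).

Definition idempotent (u : M) := op_mul u u = u.

(** The approximation axiom of a limit in isolation, so that rigidity also applies to the shift
    before it is known to be a limit. *)
Definition approximated := forall (n : nat) (a : 'I_n -> M) (e : R), 0 < e ->
  exists (A : structure R (cstar_language R)) (phi : A -> M) (b : 'I_n -> A),
    [/\ finite_dimensional_dynamics A, embedding phi &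
        forall i, mdist (phi (b i)) (a i) < e].

Lemma finite_approximation (I : finType) (a : I -> M) (e : R) :
  approximated -> 0 < e ->
  exists n (p : {perm 'I_n.+1}) (theta : finite_dynamics R ord0 p -> M)
    (b : I -> finite_dynamics R ord0 p),
    embedding theta /\ forall i, mdist (theta (b i)) (a i) < e.
Proof.
move=> aM e0; have [A [phi [b [KA ephi bP]]]] :=
  aM #|I| (fun k => a (enum_val k)) e e0.
have [n [p /isomorphic_sym[g [eg [g' g'K gK]]]]] :=
  (finite_dimensional_dynamicsP A).1 KA.
exists n, p, (phi \o g), (fun i => g' (b (enum_rank i))).
split=> [|i]; first exact: embedding_comp.
by have := bP (enum_rank i); rewrite enum_rankK /= gK.
Qed.

Lemma delta_idempotent (T : finType) (t0 : T) (p : {perm T})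
    (phi : finite_dynamics R t0 p -> M) t :
  embedding phi -> idempotent (phi (delta R t0 t)).
Proof.
move=> ephi; rewrite /idempotent -(embedding_mul ephi); congr phi.
by apply: CfunP => u; rewrite [LHS]eval_mul deltaE -natrM mulnb andbb.
Qed.

Definition zero_one (T : finType) (t0 : T) (f : Cfun R (finite_compactum t0)) :=
  forall t, f t = 0 :> R[i] \/ f t = 1 :> R[i].

Lemma zero_one_idempotent (T : finType) (t0 : T) (p : {perm T})
    (phi : finite_dynamics R t0 p -> M) f :
  embedding phi -> zero_one f -> idempotent (phi f).
Proof.
move=> ephi f01; rewrite /idempotent -(embedding_mul ephi); congr phi.
apply: CfunP => u; rewrite [LHS]eval_mul.
by case: (f01 u) => ->; rewrite ?mul0r ?mulr1.
Qed.

(* If |z^2 - z| = |z| |z - 1| is small, then z is close to 0 or 1. *)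
Lemma idempotent_rounding (u : M) (e : R) : idempotent u -> 0 < e ->
  exists2 d : R, 0 < d & forall (T : finType) (t0 : T) (p : {perm T})
    (theta : finite_dynamics R t0 p -> M) c,
    embedding theta -> mdist (theta c) u < d ->
    exists2 f, zero_one f & mdist (theta f) u < e.
Proof.
(* The idempotence defect of [c] is below [2 e'], so rounding costs at most [4 e']; with the
   distance from [theta c] to [u] the total is below [5 e']. *)
move=> iu e0; pose e' := e / 6; have e'0 : 0 < e' by rewrite divr_gt0.
have [d d0 dP] := @interp_continuous R (cstar_language R) M (Mul R) (pair2 u u) _ e'0.
exists (Num.min d e'); first by rewrite lt_min d0.
move=> T t0 p theta c etheta; rewrite lt_min => /andP[cd ce].
have cc : mdist (op_mul c c) c < e' + e'.
  rewrite -etheta.1 (embedding_mul etheta).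
  apply: le_lt_trans (metric_triangle _ u _) _; apply: ltrD; last by rewrite metric_sym.
  rewrite metric_sym -{1}iu; apply: dP => i.
  by rewrite /pair2; case: ifP => _; rewrite metric_sym.
pose f : Cfun R (finite_compactum t0) :=
  finite_fun t0 (fun t => if normc (c t : R[i]) < 1 / 2 then 0 else 1).
have cf : Cdist c f <= 4 * e'.
  apply: Cdist_le => t; rewrite finite_funE.
  have ct : normc (c t) * normc (c t - 1) <= e' + e'.
    rewrite -ComplexField.Normc.normcM mulrBr mulr1.
    by apply: le_trans (ltW cc); exact: (Cdist_ub (op_mul c c) c t).
  have n1 : 1 <= normc (c t) + normc (c t - 1).
    have := normcD (c t) (1 - c t); rewrite addrC subrK.
    by rewrite ComplexField.Normc.normc1 [normc (1 - _)]normcBC.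
  have := normc_ge0 (c t); have := normc_ge0 (c t - 1).
  case: ifPn => [c2|]; rewrite ?subr0 -?leNgt => H1 H2.
    have H3 : 1 / 2 <= normc (c t - 1) by lra.
    nra.
  move=> H3; nra.
exists f; first by move=> t; rewrite finite_funE; case: ifP => _; [left|right].
apply: le_lt_trans (metric_triangle _ (theta c) _) _.
rewrite etheta.1 (metric_sym (f : finite_dynamics R t0 p)).
have {}cf : mdist (c : finite_dynamics R t0 p) f <= 4 * e' := cf.
have : 6 * e' = e by rewrite /e'; field.
lra.
Qed.

Lemma zero_one_close (T : finType) (t0 : T) (f g : Cfun R (finite_compactum t0)) :
  zero_one f -> zero_one g -> Cdist f g < 1 -> f = g.
Proof.
move=> f01 g01 fg; apply: CfunP => t.
have := le_lt_trans (Cdist_ub f g t) fg.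
case: (f01 t) (g01 t) => -> [] -> //; rewrite ?subr0 ?sub0r ?normcN.
  by rewrite ComplexField.Normc.normc1 ltxx.
by rewrite ComplexField.Normc.normc1 ltxx.
Qed.

(** Both idempotents are rounded inside one finite-dimensional algebra, where distinct {0,1}-valued
    functions are at distance 1. *)
Lemma idempotent_rigid (u v : M) : approximated ->
  idempotent u -> idempotent v -> mdist u v < 1 / 2 -> u = v.
Proof.
move=> aM iu iv uv; apply: contrapT => /eqP; rewrite -mdist_gt0 => uv0.
(* The bound 1/8 keeps the rounded functions at distance below 1, hence equal; half of the distance
   from [u] to [v] then contradicts the triangle inequality. *)
pose e := Num.min (1 / 8) (mdist u v / 2).
have e0 : 0 < e by rewrite lt_min !divr_gt0.
have [d1 d10 d1P] := idempotent_rounding iu e0.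
have [d2 d20 d2P] := idempotent_rounding iv e0.
have d0 : 0 < Num.min d1 d2 by rewrite lt_min d10.
have [n [p [theta [b [etheta bP]]]]] :=
  finite_approximation (fun k : bool => if k then u else v) aM d0.
have [|f f01 fu] := d1P _ _ _ theta (b true) etheta.
  by have := bP true; rewrite lt_min => /andP[].
have [|g g01 gv] := d2P _ _ _ theta (b false) etheta.
  by have := bP false; rewrite lt_min => /andP[].
have [e8 e2] : e <= 1 / 8 /\ e <= mdist u v / 2.
  by rewrite /e !ge_min !lexx orbT.
have fg : f = g.
  apply: zero_one_close => //; rewrite -[Cdist f g]etheta.1.
  have := metric_triangle (theta f) u (theta g).
  have := metric_triangle u v (theta g).
  rewrite (metric_sym v); lra.
rewrite -fg in gv.
have := metric_triangle u (theta f) v; rewrite (metric_sym u (theta f)); lra.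
Qed.

Lemma embedding_delta_eq (T : finType) (t0 : T) (p : {perm T})
    (phi psi : finite_dynamics R t0 p -> M) :
  embedding phi -> embedding psi ->
  (forall t, phi (delta R t0 t) = psi (delta R t0 t)) -> phi =1 psi.
Proof.
move=> ephi epsi H f; elim/finite_fun_ind: f => [|f g fE gE|c f fE|//].
- by rewrite (embedding_zero ephi) (embedding_zero epsi).
- by rewrite (embedding_add ephi) (embedding_add epsi) fE gE.
- by rewrite (embedding_scale ephi) (embedding_scale epsi) fE.
Qed.

Lemma finite_min (I : finType) (d : I -> R) : (forall i, 0 < d i) ->
  exists2 m : R, 0 < m & forall i, m <= d i.
Proof.
move=> d0; suff [m m0 mP] : exists2 m : R, 0 < m & forall i, i \in enum I -> m <= d i.
  by exists m => // i; apply: mP; rewrite mem_enum.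
elim: (enum I) => [|i s [m m0 mP]]; first by exists 1.
exists (Num.min m (d i)); first by rewrite lt_min m0 d0.
move=> j; rewrite inE ge_min => /predU1P[->|/mP ->//].
by rewrite lexx orbT.
Qed.

(** Approximate [x] together with the images of the delta functions. Rounding gives idempotents
    within 1/2 of those images, which rigidity identifies with them, so the whole image of [phi] is
    captured. *)
Lemma exact_approximation (T : finType) (t0 : T) (p : {perm T})
    (phi : finite_dynamics R t0 p -> M) (x : M) (e : R) :
  approximated -> embedding phi -> 0 < e ->
  exists (U : finType) (u0 : U) (q : {perm U})
    (theta : finite_dynamics R u0 q -> M),
    [/\ embedding theta, forall f, exists g, theta g = phi f &
        exists b, mdist (theta b) x < e].
Proof.
move=> aM ephi e0.
have half0 : 0 < 1 / 2 :> R by rewrite divr_gt0.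
pose d t := s2val (cid2 (idempotent_rounding (delta_idempotent t ephi) half0)).
have [t|m m0 mP] := @finite_min T d; first by rewrite /d; case: cid2.
have em0 : 0 < Num.min e m by rewrite lt_min e0.
(* The index [None] stands for [x], the others for the delta functions. *)
have [n [q [theta [b [etheta bP]]]]] := finite_approximation
  (fun o : option T => if o is Some t then phi (delta R t0 t) else x) aM em0.
exists 'I_n.+1, ord0, q, theta; split => //; last first.
  by exists (b None); have := bP None; rewrite lt_min => /andP[].
have dE t : exists g, theta g = phi (delta R t0 t).
  have := bP (Some t); rewrite lt_min => /andP[_ /lt_le_trans/(_ (mP t))].
  rewrite /d; case: cid2 => r /= r0 /(_ _ _ _ theta (b (Some t)) etheta) H.
  move=> /H[g g01 gE]; exists g; apply: idempotent_rigid gE => //.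
    exact: zero_one_idempotent.
  exact: delta_idempotent.
elim/finite_fun_ind => [|f h [f' fE] [h' hE]|c f [f' fE]|//].
- by exists (op_zero _); rewrite (embedding_zero ephi) (embedding_zero etheta).
- by exists (op_add f' h'); rewrite (embedding_add ephi) (embedding_add etheta) fE hE.
- by exists (op_scale c f'); rewrite (embedding_scale ephi) (embedding_scale etheta) fE.
Qed.

(** Universality embeds the larger algebra, homogeneity moves its restriction to within 1/2 of [phi]
    on the delta functions, and rigidity turns this into equality. *)
Lemma limit_generic : fraisse_limit (@finite_dimensional_dynamics R) M ->
  generic M.
Proof.
move=> [sM aM uM hM]; split => //.
  by move=> *; exact: exact_approximation.
move=> T U t0 u0 p q i phi ei ephi.
have [psi0 epsi0] := uM _ (finite_dynamics_member R u0 q).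
have half0 : 0 < 1 / 2 :> R by rewrite divr_gt0.
have [alpha [ealpha _] alphaP] := hM _ _ _ (finite_dynamics_member R t0 p)
  (embedding_comp epsi0 ei) ephi #|T| (fun k => delta R t0 (enum_val k)) _ half0.
have epsi := embedding_comp ealpha epsi0.
exists (alpha \o psi0) => //; apply: embedding_delta_eq => //.
  exact: embedding_comp.
move=> t; have epsii := embedding_comp epsi ei.
apply: idempotent_rigid => //.
- exact: (delta_idempotent t epsii).
- exact: delta_idempotent.
- by have := alphaP (enum_rank t); rewrite enum_rankK.
Qed.

(** Universality is extension from the one-point algebra; homogeneity holds without error, by the
    back-and-forth of [M] with itself. *)
Lemma generic_limit : generic M -> approximated ->
  (exists phi : one_point_dynamics R -> M, embedding phi) ->
  fraisse_limit (@finite_dimensional_dynamics R) M.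
Proof.
move=> gM aM [phi1 ephi1]; split => //.
- exact: generic_separable.
- move=> A KA; have [iota eiota] := one_point_initial KA.
  have [n [p [h [eh _]]]] := (finite_dimensional_dynamicsP A).1 KA.
  have [psi epsi _] := generic_extension gM (embedding_comp eh eiota) ephi1.
  by exists (psi \o h); exact: embedding_comp.
- move=> A phi psi KA ephi epsi n a e e0.
  have [m [p /isomorphic_sym[g [eg [g' _ gK]]]]] :=
    (finite_dimensional_dynamicsP A).1 KA.
  have [alpha ialpha alphaE] := back_and_forth gM gM
    (embedding_comp ephi eg) (embedding_comp epsi eg).
  exists alpha => // i; have := alphaE (g' (a i)); rewrite /= gK => ->.
  by rewrite mdistxx.
Qed.

End Rigidity.

(** * The universal shift on the Cantor set *)

Definition level (k : nat) : Type := ('I_(k.+2)`! * 'I_k.+2)%type.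
HB.instance Definition _ k := Finite.on (level k).
HB.instance Definition _ k :=
  isPointed.Build (level k) (Ordinal (fact_gt0 k.+2), ord0).

Definition level_fun k (z : level k) : level k := (ordS z.1, z.2).

Lemma level_fun_inj k : injective (@level_fun k).
Proof.
move=> [z t] [z' t'] E.
by rewrite (ordS_inj (congr1 fst E : ordS z = ordS z')) (congr1 snd E : t = t').
Qed.

Definition level_perm k : {perm level k} := perm (@level_fun_inj k).

(** A product of finite discrete spaces with at least two points each is homeomorphic to the Cantor
    space. Only three elementary properties of the coordinates are kept, so the sequel avoids the
    product topology. *)
Lemma coordinates_exist (R : realType) :
  exists x : forall k, cantor_space -> level k,
    [/\ forall k y, \forall y' \near y, x k y' = x k y,
        forall y y', (forall k, x k y = x k y') -> y = y' &
        forall z : (forall k, level k), exists y, forall k, x k y = z k].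
Proof.
pose E k : topologicalType := discrete_topology (level k).
have cl : cantor_like (tree_of level).
  split.
  - apply: (@perfect_diagonal E) => k.
    (* The second factor of a level has at least two elements, which makes the product perfect. *)
    pose z : level k := point; pose z' : level k := (z.1, ord_max).
    have zz' : z <> z' by move=> /(congr1 (fun z : level k => val z.2)).
    by exists (z : E k, z' : E k); apply/eqP.
  - have cE k : compact [set: E k].
      by apply: finite_compact; exact: (@finite_finset (level k)).
    have := tychonoff cE.
    by congr compact; rewrite eqEsubset.
  - by apply: (@hausdorff_product _ E) => k; exact: discrete_hausdorff.
  - by apply: (@zero_dimension_prod _ E) => k; exact: discrete_zero_dimension.
have [f [fc _]] := @homeomorphism_cantor_like R (tree_of level) cl.
exists (fun k y => f y k); split.
- move=> k y.
  have pc : continuous (fun y => f y k : E k).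
    move=> z; apply: (@continuous_comp _ _ _ f
      (@proj nat E k)); first exact: fc.
    exact: proj_continuous.
  have := pc y [set f y k]; apply.
  exact: (@discrete_set1 (discrete_topology (level k))).
- move=> y y' fyy; apply: (@inj _ _ setT f); rewrite ?inE//.
  exact: functional_extensionality_dep.
- move=> z; have [y _ fy] := @surj _ _ setT setT f (z : tree_of level) I.
  by exists y => k; rewrite fy.
Qed.

(** * Shifts on a compact space with finite coordinates *)

Section Coordinates.
Variables (R : realType) (Y : compactum) (x : forall k, Y -> level k).
Hypothesis x_loc : forall k y, \forall y' \near y, x k y' = x k y.
Hypothesis x_sep : forall y y', (forall k, x k y = x k y') -> y = y'.
Hypothesis x_surj : forall z : (forall k, level k), exists y, forall k, x k y = z k.

Definition agree (n : nat) (y y' : Y) := forall k, (k < n)%N -> x k y' = x k y.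

Lemma agree_trans n y y' y'' : agree n y y' -> agree n y' y'' -> agree n y y''.
Proof. by move=> H H' k kn; rewrite H'// H. Qed.

Lemma agree_le m n y y' : (m <= n)%N -> agree n y y' -> agree m y y'.
Proof. by move=> mn H k km; apply: H; exact: leq_trans mn. Qed.

Lemma agree_near n y : \forall y' \near y, agree n y y'.
Proof.
elim: n => [|n IHn]; first exact: nearW.
apply: filterS2 IHn (x_loc n y) => y' yy' xn k.
by rewrite ltnS leq_eqVlt => /predU1P[->//|]; exact: yy'.
Qed.

(** Compactness: near each [z] other than [y] some coordinate stays different from that of [y], and
    finitely many such coordinates cover the space away from [A]. *)
Lemma agree_basis y (A : set Y) : nbhs y A ->
  exists n, forall y', agree n y y' -> A y'.
Proof.
move=> yA.
have /compact_near_coveringP/(_ nat \oo (fun n y' => agree n y y' -> A y')) :=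
  @compactum_compact Y.
case=> [|n _ nP]; last by exists n => y'; exact: (nP n (leqnn n)).
move=> z _; have [->|yz] := pselect (z = y).
  exists (A, setT) => /=; first by split=> //; exact: filterT.
  by move=> [y' n] /= [].
have [k kz] : exists k, x k z <> x k y.
  apply: contrapT => /forallNP H; apply: yz; apply: x_sep => k.
  exact: contrapT (H k).
exists ([set y' | x k y' = x k z], [set n | (k < n)%N]) => /=.
  by split; [exact: x_loc | exists k.+1].
by move=> [y' n] /= [y'z kn] /(_ k kn); rewrite y'z.
Qed.

(** Uniform continuity, by a covering argument from the local bound e / 2 at each point. *)
Lemma Cfun_agree (f : Cfun R Y) (e : R) : 0 < e ->
  exists n, forall y y', agree n y y' -> normc (f y - f y' : R[i]) < e.
Proof.
move=> e0; have e20 : 0 < e / 2 by rewrite divr_gt0.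
have /compact_near_coveringP/(_ nat \oo
  (fun n y => forall y', agree n y y' -> normc (f y - f y' : R[i]) < e)) :=
  @compactum_compact Y.
case=> [|n _ nP]; last by exists n => y; exact: (nP n (leqnn n)).
move=> y _; have [n nP] := agree_basis (Cfun_near f y e20).
exists ([set y' | agree n y y'], [set m | (n <= m)%N]) => /=.
  by split; [exact: agree_near | exists n].
move=> [y' m] /= [yy' nm] y'' /(agree_le nm) yy''.
apply: le_lt_trans (normc_dist _ (f y) _) _; rewrite (splitr e) ltrD//.
  by rewrite normcBC; exact: nP.
by apply: nP; exact: agree_trans yy''.
Qed.

Definition determined (T : Type) n (f : Y -> T) :=
  forall y y', agree n y y' -> f y' = f y.

Lemma determined_continuous (T : topologicalType) n (f : Y -> T) :
  determined n f -> continuous f.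
Proof.
move=> fd y; apply: cvg_near_cst; apply: filterS (agree_near n y) => y'.
exact: fd.
Qed.

Section Shift.
Variable s : forall k, {perm level k}.

Lemma shift_exists y : exists y', forall k, x k y' = s k (x k y).
Proof. exact: x_surj. Qed.

(** Built for an arbitrary family of permutations, so that the inverse homeomorphism is another
    instance; separation by coordinates makes the chosen point unique. *)
Definition shift y : Y := sval (cid (shift_exists y)).

Lemma shiftE y k : x k (shift y) = s k (x k y).
Proof. by rewrite /shift; case: cid. Qed.

Lemma shift_continuous : continuous shift.
Proof.
move=> y A /agree_basis[n nP]; apply: filterS (agree_near n y) => y' yy'.
by apply: nP => k kn; rewrite !shiftE yy'.
Qed.

End Shift.

Definition coordinate_shift : homeo Y.
Proof.
refine (@Homeo Y (shift level_perm) (shift (fun k => (level_perm k)^-1%g)) _ _ _ _).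
- exact: shift_continuous.
- exact: shift_continuous.
- by move=> y; apply: x_sep => k; rewrite !shiftE permK.
- by move=> y; apply: x_sep => k; rewrite !shiftE permKV.
Defined.

Lemma coordinate_shiftE y k : x k (coordinate_shift y) = level_fun (x k y).
Proof. by rewrite shiftE permE. Qed.

Definition prefixes n : finType := {dffun forall k : 'I_n, level k}.

Definition prefix n y : prefixes n := [ffun k : 'I_n => x k y].

Lemma prefix_determined n : determined n (prefix n).
Proof. by move=> y y' yy'; apply/ffunP => k; rewrite !ffunE yy'. Qed.

Lemma prefix_surj n (t : prefixes n) : exists y, prefix n y = t.
Proof.
(* The prefix is continued by the base point of each further level. *)
pose z k : level k := if @idP (k < n)%N is ReflectT h then t (Ordinal h) else point.
have [y yz] := x_surj z; exists y; apply/ffunP => k; rewrite ffunE yz /z.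
case: k => k kn /=; case: {-}_ / idP => [h|//].
by rewrite (bool_irrelevance h kn).
Qed.

Definition prefix_fun n (t : prefixes n) : prefixes n :=
  [ffun k : 'I_n => level_fun (t k)].

Lemma prefix_fun_inj n : injective (@prefix_fun n).
Proof.
move=> t t' /ffunP tt'; apply/ffunP => k; have := tt' k.
by rewrite !ffunE => /level_fun_inj.
Qed.

Definition prefix_perm n : {perm prefixes n} := perm (@prefix_fun_inj n).

Lemma prefix_shift n y : prefix n (coordinate_shift y) = prefix_perm n (prefix n y).
Proof. by rewrite permE; apply/ffunP => k; rewrite !ffunE coordinate_shiftE. Qed.

Definition coordinate_dynamics : structure R (cstar_language R) :=
  dynamics (induced_automorphism R coordinate_shift).

Definition determined_fun n (f : Y -> R[i]) (fd : determined n f) : Cfun R Y :=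
  mkcts (determined_continuous (T := (R[i])^o) fd).

Section DeterminedPullback.
Variables (T : finType) (t0 : T) (p : {perm T}) (n : nat) (pi : Y -> T).
Hypothesis pid : determined n pi.

Lemma comp_determined (f : T -> R[i]) : determined n (f \o pi).
Proof. by move=> y y' /pid /= ->. Qed.

Definition determined_pull (f : Cfun R (finite_compactum t0)) : Cfun R Y :=
  determined_fun (comp_determined (fun t => f t)).

Lemma determined_pullE f y : determined_pull f y = f (pi y) :> R[i].
Proof. by []. Qed.

Lemma determined_pull_embedding : (forall t, exists y, pi y = t) ->
  (forall y, pi (coordinate_shift y) = p (pi y)) ->
  embedding (determined_pull : finite_dynamics R t0 p -> coordinate_dynamics).
Proof.
move=> pis pip.
apply: (@pullback_embedding R Y (finite_compactum t0)
  (induced_automorphism R coordinate_shift)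
  (induced_automorphism R (perm_homeo t0 p)) _ pi) => // f.
by apply: CfunP => y; exact: (congr1 (fun t => f t : R[i]) (esym (pip y))).
Qed.

End DeterminedPullback.

Lemma exists_bound (I : finType) (P : I -> nat -> Prop) :
  (forall i, exists n, P i n) -> (forall i m n, (m <= n)%N -> P i m -> P i n) ->
  exists n, forall i, P i n.
Proof.
move=> /choice[n nP] Pm; exists (\max_i n i) => i.
exact: Pm (leq_bigmax i) (nP i).
Qed.

(** By uniform continuity the tuple almost depends on a finite prefix; sampling it at one point
    [l t] per prefix [t] gives functions on the finite space of prefixes. *)
Lemma coordinate_approximated : approximated coordinate_dynamics.
Proof.
move=> n a e e0; have e20 : 0 < e / 2 by rewrite divr_gt0.
have [||N NP] := @exists_bound 'I_n (fun i m => forall y y', agree m y y' ->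
    normc ((a i : Cfun R Y) y - (a i : Cfun R Y) y' : R[i]) < e / 2).
- by move=> i; exact: Cfun_agree.
- by move=> i m m' mm' H y y' /(agree_le mm'); exact: H.
have [y0] := compactum_inhabited Y.
have ePhi := @determined_pull_embedding _ (prefix N y0) (prefix_perm N) _ _
  (@prefix_determined N) (@prefix_surj N) (@prefix_shift N).
set Phi := (X in embedding X) in ePhi.
have /choice[l lP] := @prefix_surj N.
exists (finite_dynamics R (prefix N y0) (prefix_perm N)), Phi,
  (fun i => finite_fun _ (fun t => (a i : Cfun R Y) (l t) : R[i])).
split => //; first exact: finite_dynamics_member.
move=> i; apply: (@le_lt_trans _ _ (e / 2)); last by lra.
apply: Cdist_le => y; rewrite determined_pullE finite_funE; apply: ltW.
apply: NP => k kN.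
by have /ffunP/(_ (Ordinal kN)) := lP (prefix N y); rewrite !ffunE.
Qed.

Lemma coordinate_separable :
  exists2 D : set coordinate_dynamics, countable D & dense D.
Proof.
pose J : countType := {n : nat & {ffun prefixes n -> rat * rat}}.
have dJ (j : J) : determined (projT1 j)
    (fun y => ratC R (projT2 j (prefix (projT1 j) y))).
  by move=> y y' /prefix_determined ->.
pose F (j : J) : coordinate_dynamics := determined_fun (dJ j).
exists (range F).
  exact: (card_le_trans (card_image_le _ _) (countableP [set: J])).
move=> O [f Of] oO.
have /nbhs_ballP[e /= e0 eO] : nbhs f O by apply: open_nbhs_nbhs.
have e40 : 0 < e / 4 by rewrite divr_gt0.
have [n nP] := Cfun_agree f e40.
have /choice[l lP] := @prefix_surj n.
have /choice[r rP] : forall t, exists q,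
    normc ((f : Cfun R Y) (l t) - ratC R q : R[i]) < e / 4.
  by move=> t; exact: ratC_dense.
pose j : J := existT _ n [ffun t => r t].
exists (F j); split; last by exists j.
apply: eO; rewrite ballEmdist /=.
apply: (@le_lt_trans _ _ (e / 4 + e / 4)); last by lra.
apply: Cdist_le => y; apply: le_trans (normc_dist _ (f (l (prefix n y))) _) _.
apply: lerD.
  apply/ltW/nP => k kn.
  by have /ffunP/(_ (Ordinal kn)) := lP (prefix n y); rewrite !ffunE.
have := ltW (rP (prefix n y)); rewrite -[r _](ffunE r).
exact.
Qed.

Lemma iter_perm_order (U : finType) (q : {perm U}) n u :
  (#[q]%g %| n)%N -> iter n q u = u.
Proof.
by move=> /dvdnP[k ->]; rewrite -permX mulnC expgM expg_order expg1n perm1.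
Qed.

(* With [z] the cyclic part of coordinate [j] and [t] its invariant part, the
   lift of [pi] along [g] is [q^z (s (p^-z (pi y)) t)], where [s a t] runs
   over the fiber of [g] at [a] as [t] varies; it is well defined since the
   order of [q], hence that of [p], divides the modulus of [z]. *)
Lemma lift_factor_map (T U : finType) (p : {perm T}) (q : {perm U})
    (g : U -> T) (n : nat) (pi : Y -> T) :
  (forall u, g (q u) = p (g u)) -> (forall t, exists u, g u = t) ->
  determined n pi -> (forall t, exists y, pi y = t) ->
  (forall y, pi (coordinate_shift y) = p (pi y)) ->
  exists m (pi' : Y -> U),
    [/\ determined m pi', forall u, exists y, pi' y = u,
        forall y, pi' (coordinate_shift y) = q (pi' y) &
        forall y, g (pi' y) = pi y].
Proof.
move=> gq gs pid pis pip.
have [ginv ginvK] := choice gs.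
(* Since [j] is at least [n], the map [pi] ignores coordinate [j]; since [j.+2] is at least the
   order of [q], that order divides [m]; since [j.+2] is at least the size of [U], the label can
   index every element of [U]. *)
pose j := (n + #[q]%g + #|U|)%N; pose m := (j.+2)`!.
have qm u : iter m q u = u.
  apply: iter_perm_order; apply: dvdn_fact; rewrite order_gt0.
  by rewrite /j -!addnS -addnA (leq_trans _ (leq_addl _ _))// leq_addr.
have giter k u : g (iter k q u) = iter k p (g u).
  by elim: k => //= k IHk; rewrite gq IHk.
have pm t : iter m p t = t by rewrite -(ginvK t) -giter qm.
(* A label naming an element outside the fiber over [a] falls back on [ginv a]. *)
pose s a (t : nat) := let u := nth (ginv a) (enum U) t in
  if g u == a then u else ginv a.
have gsE a t : g (s a t) = a by rewrite /s; case: eqP.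
pose lift (w : level j) a := iter w.1 q (s (iter (m - w.1) p a) w.2).
exists j.+1, (fun y => lift (x j y) (pi y)); split.
- move=> y y' yy'; rewrite (yy' j (ltnSn j)) (pid y y')//.
  by apply: agree_le yy'; rewrite /j ltnW// ltnS -addnA leq_addr.
- move=> u; have [y0 y0u] := pis (g u).
  have uj : (index u (enum U) < j.+2)%N.
    rewrite (leq_trans (_ : _ < #|U|)%N)//.
      by rewrite cardE index_mem mem_enum.
    by rewrite /j -!addnS (leq_trans _ (leq_addl _ _))// -addn2 leq_addr.
  (* To reach [u], take cyclic part 0 and the index of [u] as label; changing coordinate [j] alone
     preserves the value of [pi]. *)
  pose w : level j := (Ordinal (fact_gt0 j.+2), Ordinal uj).
  have [y yw] := x_surj (dfwith (fun k => x k y0) j w); exists y.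
  rewrite yw dfwithin /lift /= subn0 pm (pid y0 y) ?y0u.
    by rewrite /s nth_index ?mem_enum// eqxx.
  move=> k kn; rewrite yw dfwithout//.
  by apply/eqP => jk; move: kn; rewrite -jk /j -addnA ltnNge leq_addr.
- move=> y; rewrite coordinate_shiftE pip /lift.
  set w := x j y; have := ltn_ord w.1; rewrite -/m.
  have -> : nat_of_ord (level_fun w).1 = (w.1.+1 %% m)%N by [].
  have -> : (level_fun w).2 = w.2 by [].
  move: (nat_of_ord w.1) (nat_of_ord w.2) => z t.
  (* The first case is the wrap-around of the cyclic part to 0, absorbed by the triviality of the
     [m]-th powers of [p] and [q]. *)
  rewrite leq_eqVlt => /predU1P[zm|zm].
    rewrite zm modnn subn0 pm [in RHS](_ : m - z = 1)%N ?[iter 0 _ _]/=.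
      by rewrite [iter 1 _ _]/= -iterS zm qm.
    by rewrite -zm subSnn.
  by rewrite modn_small// -iterSr subnSK ?(ltnW zm)// -iterS.
- by move=> y; rewrite /lift giter gsE -iterD subnKC ?pm// ltnW// ltn_ord.
Qed.

Lemma coordinate_extension (T U : finType) (t0 : T) (u0 : U) (p : {perm T})
    (q : {perm U}) (i : finite_dynamics R t0 p -> finite_dynamics R u0 q)
    (phi : finite_dynamics R t0 p -> coordinate_dynamics) :
  embedding i -> embedding phi ->
  exists2 psi : finite_dynamics R u0 q -> coordinate_dynamics, embedding psi &
    forall f, psi (i f) = phi f.
Proof.
move=> /finite_embedding_surjection[g [gE gs gq]] ephi.
have [pi [piE pis]] := finite_embedding_pullback ephi.
have pip y : pi (coordinate_shift y) = p (pi y).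
  have := embedding_sigma ephi (delta R t0 (p (pi y))).
  move=> /(congr1 (fun f : Cfun R Y => f y : R[i])).
  have -> : (op_sigma (phi (delta R t0 (p (pi y)))) : Cfun R Y) y =
    (phi (delta R t0 (p (pi y))) : Cfun R Y) (coordinate_shift y) by [].
  rewrite !piE.
  have -> : (op_sigma (delta R t0 (p (pi y)) : finite_dynamics R t0 p)
    : Cfun R (finite_compactum t0)) (pi y) =
    (delta R t0 (p (pi y))) (p (pi y)) by [].
  by rewrite !deltaE eqxx; case: eqP => //= _ /eqP; rewrite oner_eq0.
(* The images of delta functions take only the values 0 and 1, so oscillation below 1 on prefixes
   makes [pi] depend on a prefix. *)
have [||n nP] := @exists_bound T (fun t m => forall y y', agree m y y' ->
    normc ((phi (delta R t0 t) : Cfun R Y) y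
      - (phi (delta R t0 t) : Cfun R Y) y' : R[i]) < 1).
- by move=> t; apply: Cfun_agree.
- by move=> t m m' mm' H y y' /(agree_le mm'); exact: H.
have pid : determined n pi.
  move=> y y' /(nP (pi y)); rewrite !piE !deltaE eqxx.
  case: eqP => // _; rewrite subr0 ComplexField.Normc.normc1 ltxx//.
have [m [pi' [pid' pis' pip' gpi']]] := lift_factor_map gq gs pid pis pip.
exists (determined_pull pid'); first exact: determined_pull_embedding.
by move=> f; apply: CfunP => y; rewrite determined_pullE gE piE gpi'.
Qed.

Lemma coordinate_limit :
  fraisse_limit (@finite_dimensional_dynamics R) coordinate_dynamics.
Proof.
apply: generic_limit.
- split.
  + exact: coordinate_separable.
  + by move=> *; apply: exact_approximation => //; exact: coordinate_approximated.
  + exact: coordinate_extension.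
- exact: coordinate_approximated.
(* Approximating the empty tuple yields some embedded member, through which the one-point algebra
   embeds. *)
- have [A [phi [_ [KA ephi _]]]] := @coordinate_approximated 0 (@no_args _) 1 ltr01.
  have [iota eiota] := one_point_initial KA.
  by exists (phi \o iota); exact: embedding_comp.
Qed.

End Coordinates.

(** * The Fraisse limit on the Cantor set and its uniqueness *)

Theorem theorem4p1 (R : realType) :
  fraisse_class (@finite_dimensional_dynamics R) /\
  exists S : homeo cantor_compactum,
    fraisse_limit (@finite_dimensional_dynamics R)
      (dynamics (induced_automorphism R S)) /\
    forall M : structure R (cstar_language R),
      fraisse_limit (@finite_dimensional_dynamics R) M ->
      isomorphic M (dynamics (induced_automorphism R S)).
Proof.
split; first exact: finite_dimensional_fraisse_class.
have [x [xl xs xj]] := coordinates_exist R.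
pose S := @coordinate_shift cantor_compactum x xl xs xj.
have limS := @coordinate_limit R cantor_compactum x xl xs xj.
exists S; split=> // M limM.
have K1 := finite_dynamics_member R (ord0 : 'I_1) 1%g.
have [phi ephi] := limit_universal limM K1.
have [psi epsi] := limit_universal limS K1.
have [alpha ialpha _] :=
  back_and_forth (limit_generic limM) (limit_generic limS) ephi epsi.
by exists alpha.
Qed.
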